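(* Let $n$ be a positive integer, let $f:\mathbb{R}^n\to\mathbb{R}$ be an almost periodic function, and let $u:\mathbb{R}^n\to\mathbb{R}$ be a bounded continuous function. Assume that $u$ is a solution of Poisson's equation $-\Delta u=f$ in $\mathbb{R}^n$ in the sense of distributions. Then $u$ has continuous partial derivatives $\partial u/\partial x_i$, $i=1,\dots,n$, on $\mathbb{R}^n$, and each $\partial u/\partial x_i$ is an almost periodic function on $\mathbb{R}^n$.
   Context: A function $g:\mathbb{R}^n\to\mathbb{R}$ is called almost periodic if it is continuous on $\mathbb{R}^n$ and for every sequence of points $(x_k)$ in $\mathbb{R}^n$ the sequence of translates $x\mapsto g(x+x_k)$ contains a subsequence converging uniformly on $\mathbb{R}^n$. $\mathcal{D}(\mathbb{R}^n)$ denotes the set of infinitely differentiable functions $\phi:\mathbb{R}^n\to\mathbb{R}$ with compact support. The function $u$ solves $-\Delta u=f$ in the sense of distributions if $-\int_{\mathbb{R}^n}u\,\Delta\phi\,dx=\int_{\mathbb{R}^n}f\,\phi\,dx$ for every $\phi\in\mathcal{D}(\mathbb{R}^n)$. *)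

(* Defs.v *)
From HB Require Import structures.
From mathcomp Require Import all_boot all_order all_algebra.
From mathcomp Require Import all_classical all_reals all_analysis.

Set Implicit Arguments.
Unset Strict Implicit.
Unset Printing Implicit Defensive.

Import Order.TTheory GRing.Theory Num.Theory.
Import numFieldNormedType.Exports.

Local Open Scope classical_set_scope.
Local Open Scope ring_scope.

(* Lebesgue measure on R^n is obtained by induction on n: the image of the
   product of the 1-dimensional Lebesgue measure with the n-dimensional one
   under (x, t) |-> x :: t.  Points are n-tuples here because n.-tuple carries
   the product sigma-algebra in the library, whereas 'rV[R]_n has none. *)
Section lebesgue_measure_Rn.
Context {R : realType}.

Definition cons_pair (n : nat)
    (p : measurableTypeR R * n.-tuple (measurableTypeR R)) :
    n.+1.-tuple (measurableTypeR R) :=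
  [tuple of p.1 :: p.2].

Lemma measurable_cons_pair n : measurable_fun [set: _] (@cons_pair n).
Proof. exact: measurable_cons. Qed.

Section step.
Context (n : nat).
Variable mu : {sigma_finite_measure set (n.-tuple (measurableTypeR R)) -> \bar R}.

Definition lebesgue_cons :
    set (n.+1.-tuple (measurableTypeR R)) -> \bar R :=
  pushforward (@lebesgue_measure R \x mu)%E (@cons_pair n).

Let lebesgue_cons0 : lebesgue_cons set0 = 0%E.
Proof. by rewrite /lebesgue_cons /pushforward preimage_set0 measure0. Qed.

Let lebesgue_cons_ge0 A : (0 <= lebesgue_cons A)%E.
Proof. by rewrite /lebesgue_cons /pushforward measure_ge0. Qed.

Let lebesgue_cons_sigma_additive : semi_sigma_additive lebesgue_cons.
Proof.
exact: (@measure_semi_sigma_additive _ _ _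
  (measure_function_pushforward__canonical__measure_function_Measure
    (lebesgue_measure \x mu)%E (@measurable_cons_pair n))).
Qed.

HB.instance Definition _ := isMeasure.Build _ _ _ lebesgue_cons
  lebesgue_cons0 lebesgue_cons_ge0 lebesgue_cons_sigma_additive.

Let lebesgue_cons_sigma_finite : sigma_finite setT lebesgue_cons.
Proof.
have /sigma_finiteP[F [FT ndF Foo]] := sigma_finiteT (@lebesgue_measure R).
have /sigma_finiteP[G [GT ndG Goo]] := sigma_finiteT mu.
pose uncons (t : n.+1.-tuple (measurableTypeR R)) :=
  (thead t, [tuple of behead t]).
have muncons : measurable_fun [set: _] uncons.
  apply: measurable_fun_pair; [exact: measurable_tnth|exact: measurable_behead].
have unconsK (p : measurableTypeR R * n.-tuple (measurableTypeR R)) :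
    uncons (cons_pair p) = p.
  by case: p => x t; congr pair; apply: val_inj.
exists (fun k => uncons @^-1` (F k `*` G k)).
  apply/seteqP; split=> // t _.
  have [i _ Fi] : (\bigcup_k F k) (uncons t).1 by rewrite -FT.
  have [j _ Gj] : (\bigcup_k G k) (uncons t).2 by rewrite -GT.
  exists (maxn i j) => //; split.
    by move: Fi; exact/subsetPset/ndF/leq_maxl.
  by move: Gj; exact/subsetPset/ndG/leq_maxr.
move=> k; have [mF Fk] := Foo k; have [mG Gk] := Goo k; split.
  by rewrite -[X in measurable X]setTI; apply: muncons => //; exact: measurableX.
rewrite /lebesgue_cons /pushforward -comp_preimage.
rewrite (_ : uncons \o _ = id); last by apply/funext => p; exact: unconsK.
by rewrite preimage_id product_measure1E// lte_mul_pinfty// ge0_fin_numE.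
Qed.

HB.instance Definition _ := Measure_isSigmaFinite.Build _ _ _
  lebesgue_cons lebesgue_cons_sigma_finite.

End step.

Fixpoint lebesgue_Rn (n : nat) :
    {sigma_finite_measure set (n.-tuple (measurableTypeR R)) -> \bar R} :=
  match n with
  | 0 => \d_ ([tuple] : 0.-tuple (measurableTypeR R))
  | m.+1 => lebesgue_cons (lebesgue_Rn m)
  end.

Lemma lebesgue_Rn_box n (A : 'I_n -> set (measurableTypeR R)) :
  (forall i, measurable (A i)) ->
  lebesgue_Rn n [set t | forall i, A i (tnth t i)] =
  (\prod_(i < n) lebesgue_measure (A i))%E.
Proof.
elim: n A => [|n IH] A mA.
  by rewrite big_ord0 /= diracE mem_set// => -[].
rewrite big_ord_recl -(IH (fun i => A (lift ord0 i)))//=.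
rewrite /lebesgue_cons /pushforward.
have mB : measurable [set t : n.-tuple (measurableTypeR R) |
    forall i, A (lift ord0 i) (tnth t i)].
  rewrite (_ : [set _ | _] = \bigcap_(i in [set: 'I_n])
      ((fun t => tnth t i) @^-1` A (lift ord0 i))).
    apply: fin_bigcap_measurable => // i _; rewrite -[X in measurable X]setTI.
    exact: measurable_tnth.
  by apply/seteqP; split=> [t At i _|t At i]; apply: At.
rewrite -product_measure1E//; congr (_ _).
apply/seteqP; split => -[x t] /=.
  move=> At; split; first by have := At ord0; rewrite tnth0.
  by move=> i; have := At (lift ord0 i); rewrite tnthS.
by move=> [Ax At] i; case: (unliftP ord0 i) => [j ->|->];
  rewrite ?tnthS ?tnth0.
Qed.

Definition integral_Rn (n : nat) (F : 'rV[R]_n -> R) : R :=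
  \int[lebesgue_Rn n]_t F (\row_i tnth t i).

End lebesgue_measure_Rn.

Section function_classes.
Context {R : realType} (n : nat).

Definition partial (i : 'I_n) (g : 'rV[R]_n -> R) : 'rV[R]_n -> R :=
  'D_(delta_mx ord0 i) g.

Definition has_partial (i : 'I_n) (g : 'rV[R]_n -> R) : Prop :=
  forall x, derivable g x (delta_mx ord0 i).

Fixpoint Ck (k : nat) (g : 'rV[R]_n -> R) : Prop :=
  continuous g /\
  match k with
  | 0 => True
  | m.+1 => forall i : 'I_n, has_partial i g /\ Ck m (partial i g)
  end.

Definition test_function (phi : 'rV[R]_n -> R) : Prop :=
  (forall k, Ck k phi) /\ compact (closure [set x | phi x != 0]).

Definition laplacian (g : 'rV[R]_n -> R) : 'rV[R]_n -> R :=
  fun x => \sum_(i < n) partial i (partial i g) x.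

Definition poisson_distr (u f : 'rV[R]_n -> R) : Prop :=
  forall phi, test_function phi ->
    - integral_Rn (fun x => u x * laplacian phi x) =
    integral_Rn (fun x => f x * phi x).

Definition almost_periodic (g : 'rV[R]_n -> R) : Prop :=
  continuous g /\
  forall xs : nat -> 'rV[R]_n,
    exists s : nat -> nat, {homo s : i j / (i < j)%N} /\
    exists h : 'rV[R]_n -> R,
      {uniform, (fun k x => g (x + xs (s k))) @ \oo --> h}.

End function_classes.

(* Main.v *)
(* The proof rests on the interpolation inequality
     [sup |d_i w| <= n M / d + N d / 2   for every d > 0]
   for w of class C^2 with |w| <= M and |laplacian w| <= N, obtained from the
   maximum principle on a half cube by an explicit barrier (Gilbarg and
   Trudinger, Section 3.4).  Its first term does not see the Laplacian, so
   letting d grow shows that, in a fixed bounded family, the gradients are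
   uniformly small once the Laplacians are.
   Mollifying u and f gives smooth bounded functions with -laplacian u_k = f_k,
   and f_k -> f uniformly because f is uniformly continuous.  The inequality
   applied to u_k - u_l shows that the gradients of the u_k are uniformly Cauchy,
   hence u is differentiable; applied to the translates u_k(. + a) - u_k(. + b)
   it shows that the gradient of u varies uniformly little under translations
   under which f varies uniformly little, which is almost periodicity. *)
Require Import Defs.
From mathcomp Require Import all_boot all_order all_algebra.
From mathcomp Require Import all_classical all_reals all_analysis.
From mathcomp Require Import measurable_realfun.
From mathcomp Require Import ring lra.
Import Order.TTheory GRing.Theory Num.Theory.
Import numFieldNormedType.Exports.
Local Open Scope classical_set_scope.
Local Open Scope ring_scope.
Set Implicit Arguments.
Unset Strict Implicit.
Unset Printing Implicit Defensive.

(** * The gradient bound by the maximum principle *)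

(** Since [u] is only bounded and continuous, its mollifications are controlled pointwise, while
    their Laplacians converge uniformly. This asymmetry dictates the form of the estimates: they
    bound increments [w (x + h *: e_ i) - w x] by a small multiple of [|h|]. For fixed [x] and [h]
    such a bound survives a pointwise limit, and small [h] then turns it into a statement on partial
    derivatives. The translates of [u] are never compared in the sup norm; differences of two of
    them enter only through the bound [2 * M]. The maximum principle is likewise run on second
    differences, whose sign at an interior maximum is read off from values alone. *)

Section landau.
Context {R : realType} {n : nat}.
Implicit Types (w : 'rV[R]_n -> R) (x y z p : 'rV[R]_n) (i j : 'I_n).

Local Notation e_ j := (delta_mx ord0 j : 'rV[R]_n).

Lemma unit_vectorE (t : R) i j : (t *: e_ i) ord0 j = t * (j == i)%:R.
Proof. by rewrite !mxE eqxx. Qed.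

(** Discrete counterpart of [t ^+ 2] times the Laplacian. It is nonpositive at a maximum over a set
    containing the whole stencil. *)
Definition second_difference w (t : R) p : R :=
  \sum_j (w (p + t *: e_ j) + w (p - t *: e_ j) - 2 * w p).

Definition reflection i y : 'rV[R]_n := y - (2 * y ord0 i) *: e_ i.

Lemma reflectionD i y t j :
  reflection i (y + t *: e_ j) =
  reflection i y + (if j == i then - t else t) *: e_ j.
Proof.
apply/rowP => k; rewrite !mxE eqxx /= (eq_sym i j).
case: (eqVneq j i) => [->|ij].
  by case: (k == i) => /=; ring.
by case: (k == i); case: (k == j) => /=; ring.
Qed.

(** The stencil is symmetric, so reflecting it only swaps the two points in direction [i]. *)
Lemma second_difference_reflection w t i x z :
  second_difference (fun y => w (x + reflection i y)) t z =
  second_difference w t (x + reflection i z).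
Proof.
apply: eq_bigr => j _; rewrite -[z - _]/(z + _) -scaleNr !reflectionD.
rewrite !addrA; case: ifP => _; rewrite ?opprK ?scaleNr//.
by ring.
Qed.

Lemma continuous_reflection i : continuous (reflection i).
Proof.
move=> y; rewrite /reflection; apply: (@cvgB _ _ _ (nbhs y)); first exact: cvg_id.
apply: cvgZr_tmp; apply: (@cvgMl_tmp _ _ _ _ (fun y : 'rV[R]_n => y ord0 i)).
exact: coord_continuous.
Qed.

(* The comparison function of Gilbarg and Trudinger, Section 3.4: it dominates
   the odd part of w across [y_i = 0] on the boundary of the half cube
   [|y_j| <= d, 0 <= y_i <= d], and its Laplacian is -N. *)
Definition barrier (M N d : R) i y : R :=
  M / d ^+ 2 * (\sum_j y ord0 j ^+ 2) +
  (n%:R * M / d ^+ 2 + N / 2) * (y ord0 i * (d - y ord0 i)).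

(** The barrier is quadratic, so there is no error term: the sum of squares gives
    [2 * n * M / d ^+ 2], which the term in [y_i * (d - y_i)] cancels, leaving [- N]. *)
Lemma second_difference_barrier M N d i t z :
  second_difference (barrier M N d i) t z = - N * t ^+ 2.
Proof.
rewrite /second_difference /barrier.
have sq (s : R) j : \sum_k (z + s *: e_ j) ord0 k ^+ 2 =
    \sum_k z ord0 k ^+ 2 + 2 * s * z ord0 j + s ^+ 2.
  under eq_bigr do rewrite mxE unit_vectorE.
  rewrite (bigD1 j)//= eqxx [in RHS](bigD1 j)//=.
  rewrite (eq_bigr (fun k => z ord0 k ^+ 2)); last first.
    by move=> k /negbTE ->; rewrite mulr0 addr0.
  by ring.
rewrite (eq_bigr (fun j => M / d ^+ 2 * (2 * t ^+ 2) +
   (j == i)%:R * (- (n%:R * M / d ^+ 2 + N / 2) * (2 * t ^+ 2)))); last first.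
  move=> j _; rewrite -[z - _]/(z + _) -scaleNr !sq !mxE eqxx /= (eq_sym i j).
  by case: (eqVneq j i) => [->|_] /=; ring.
rewrite big_split/= sumr_const card_ord (bigD1 i)//= eqxx big1 ?addr0; last first.
  by move=> j /negbTE ->; rewrite mul0r.
rewrite -[_ *+ n]mulr_natl; set v := (d ^+ 2)^-1.
rewrite mul1r.
by field.
Qed.

Lemma continuous_barrier M N d i : continuous (barrier M N d i).
Proof.
have cc j : continuous (fun y : 'rV[R]_n => y ord0 j) by exact: coord_continuous.
move=> y; apply: (@cvgD _ _ _ (nbhs y)); apply: (@cvgMl_tmp _ _ (nbhs y)).
  apply: (cvg_big add_continuous) => j _.
  apply: (@cvg_comp _ _ _ (fun y : 'rV[R]_n => y ord0 j) (fun t : R => t ^+ 2)).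
    exact: cc.
  exact: exprn_continuous.
apply: (@cvgM _ _ (nbhs y)); first exact: cc.
by apply: (@cvgB _ _ _ (nbhs y)); [exact: cvg_cst|exact: cc].
Qed.

(** Maximum principle for the odd part of [w] minus the barrier on the half cube. The strict bound
    on second differences excludes an interior positive maximum without perturbing the barrier. *)
Lemma symmetric_increment_le w (M N d s : R) i x :
  continuous w -> (forall p, `|w p| <= M) -> 0 < d -> 0 <= s <= d ->
  (forall p, \forall t \near 0^'+, `|second_difference w t p| < N * t ^+ 2) ->
  w (x + s *: e_ i) - w (x - s *: e_ i) <=
  2 * s * (n%:R * M / d + N * d / 2).
Proof.
move=> cw wM d0 /andP[s0 sd] wN.
have M0 : 0 <= M by exact: le_trans (wM 0).
have N0 : 0 <= N.
  have [t /= []] := @filter_ex _ (0 : R)^'+ _ _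
    (filterI (wN 0) (@nbhs_right_gt R 0)).
  move=> wt t0; have := le_lt_trans (normr_ge0 _) wt.
  by rewrite pmulr_lgt0 ?exprn_gt0// => /ltW.
(* The odd part vanishes on the face [y_i = 0]; the factor 1/2 keeps it below [M] and its second
   differences below [N * t ^+ 2]. At [s *: e_ i] it is half the increment to be bounded. *)
pose phi y := (w (x + y) - w (x + reflection i y)) / 2.
pose g y := phi y - barrier M N d i y.
pose lo j : R := if j == i then 0 else - d.
pose Q := [set y : 'rV[R]_n | forall j, y ord0 j \in `[lo j, d]].
have lod j : lo j <= d by rewrite /lo; case: ifP => _; lra.
have cQ : compact Q.
  apply: (@rV_compact _ _ (fun j => `[lo j, d]%classic)) => j.
  exact: segment_compact.
have cg : continuous g.
  move=> y; apply: (@cvgB _ _ _ (nbhs y)); last exact: continuous_barrier.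
  apply: (@cvgMr_tmp _ _ (nbhs y)); apply: (@cvgB _ _ _ (nbhs y)).
    apply: (@cvg_comp _ _ _ (fun y => x + y) w); last exact: cw.
    by apply: (@cvgD _ _ _ (nbhs y)); [exact: cvg_cst|exact: cvg_id].
  apply: (@cvg_comp _ _ _ (fun y => x + reflection i y) w); last exact: cw.
  by apply: (@cvgD _ _ _ (nbhs y)); [exact: cvg_cst|exact: continuous_reflection].
have Qs : Q (s *: e_ i).
  move=> j; rewrite unit_vectorE in_itv/= /lo; case: eqP => _ /=; apply/andP; split; lra.
have [z zQ gz] := compact_EVT_max (ex_intro _ _ Qs) cQ (continuous_subspaceT cg).
rewrite inE in zQ.
have zlo j : lo j <= z ord0 j <= d by have := zQ j; rewrite in_itv.
have zi0 : 0 <= z ord0 i by have /andP[+ _] := zlo i; rewrite /lo eqxx.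
have zid : z ord0 i <= d by have /andP[] := zlo i.
have Md0 : 0 <= M / d ^+ 2 by rewrite divr_ge0// exprn_ge0// ltW.
have b1 : 0 <= (n%:R * M / d ^+ 2 + N / 2) * (z ord0 i * (d - z ord0 i)).
  apply: mulr_ge0; last by apply: mulr_ge0 => //; lra.
  by rewrite -mulrA addr_ge0// ?divr_ge0// mulr_ge0.
have b2 : 0 <= \sum_j z ord0 j ^+ 2 by apply: sumr_ge0 => j _; exact: sqr_ge0.
(* Where [y_i = 0], [phi] vanishes; where some [|y_j| = d], the single term [M / d ^+ 2 * y_j ^+ 2]
   already equals [M]; elsewhere [z] is interior, which is contradictory. *)
have gz0 : g z <= 0.
  rewrite /g subr_le0 /barrier.
  have [zi|zi_neq0] := eqVneq (z ord0 i) 0.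
    rewrite /phi /reflection zi mulr0 scale0r subr0 subrr mul0r.
    by rewrite zi in b1; rewrite addr_ge0// mulr_ge0.
  have phiM y : phi y <= M.
    rewrite /phi ler_pdivrMr// mulrDr mulr1 lerD//.
      by apply: le_trans (wM _); exact: ler_norm.
    by apply: le_trans (wM (x + reflection i y)); rewrite -normrN ler_norm.
  have [[j zj]|zint] := pselect (exists j, `|z ord0 j| = d).
    apply: le_trans (phiM z) _; rewrite -[leLHS]addr0 lerD//.
    rewrite -[leLHS](divfK (lt0r_neq0 (exprn_gt0 2 d0))) ler_wpM2l//.
    rewrite -zj (bigD1 j)//= real_normK ?num_real// lerDl.
    by apply: sumr_ge0 => k _; exact: sqr_ge0.
  have zlt j : lo j < z ord0 j < d.
    have /andP[h1 h2] := zlo j; rewrite !lt_neqAle h1 h2 !andbT; apply/andP; split.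
      apply/eqP => h; move: h1 h; rewrite /lo; case: eqP => [->|_] h1 h.
        by rewrite -h eqxx in zi_neq0.
      by apply: zint; exists j; rewrite -h normrN gtr0_norm.
    by apply/eqP => h; apply: zint; exists j; rewrite h gtr0_norm.
  have /= nQ : \forall t \near (0 : R)^'+, forall j,
      Q (z + t *: e_ j) /\ Q (z - t *: e_ j).
    apply: filter_forall => j.
    have /andP[h1 h2] := zlt j.
    have h3 : 0 < z ord0 j - lo j by lra.
    have h4 : 0 < d - z ord0 j by lra.
    near=> t.
    have t0 : 0 < t by [].
    have t1 : t < z ord0 j - lo j by near: t; exact: nbhs_right_lt.
    have t2 : t < d - z ord0 j by near: t; exact: nbhs_right_lt.
    rewrite -scaleNr; split => k; rewrite mxE unit_vectorE in_itv/=.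
      have /andP[h5 h6] := zlo k.
      by case: (eqVneq k j) => [->|_]; rewrite ?mulr1 ?mulr0 ?addr0; apply/andP; split; lra.
    have /andP[h5 h6] := zlo k.
    by case: (eqVneq k j) => [->|_]; rewrite ?mulr1 ?mulr0 ?addr0; apply/andP; split; lra.
  (* For such a [t] the second difference of [g] is nonpositive by maximality, yet exceeds
     [- N * t ^+ 2 + N * t ^+ 2 = 0]. *)
  suff [t [h1 h2 h3]] : exists t, [/\ forall j, Q (z + t *: e_ j) /\ Q (z - t *: e_ j),
     `|second_difference w t (x + z)| < N * t ^+ 2 &
     `|second_difference w t (x + reflection i z)| < N * t ^+ 2].
    have : second_difference g t z <= 0.
      apply: sumr_le0 => j _; have [q1 q2] := h1 j.
      have := gz _ (mem_set q1); have := gz _ (mem_set q2); lra.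
    have -> : second_difference g t z =
        (second_difference w t (x + z) - second_difference w t (x + reflection i z)) / 2
        - second_difference (barrier M N d i) t z.
      rewrite -(second_difference_reflection w t i x z) /second_difference.
      rewrite -sumrB mulr_suml -sumrB; apply: eq_bigr => j _.
      by rewrite /g /phi /= !(addrA x); field.
    rewrite second_difference_barrier.
    by move: h2 h3; rewrite !ltr_norml => /andP[? ?] /andP[? ?]; lra.
  have [t /= []] := @filter_ex _ (0 : R)^'+ _ _
    (filterI nQ (filterI (wN (x + z)) (wN (x + reflection i z)))).
  by move=> h1 [h2 h3]; exists t; split.
have := le_trans (gz _ (mem_set Qs)) gz0.
rewrite /g subr_le0 /phi /barrier.
have -> : reflection i (s *: e_ i) = - (s *: e_ i).
  by rewrite /reflection unit_vectorE eqxx mulr1; apply/rowP => k; rewrite !mxE; ring.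
rewrite unit_vectorE eqxx mulr1 (bigD1 i)//= big1 ?addr0 => [|j ji]; last first.
  by rewrite unit_vectorE (negbTE ji) mulr0 expr0n.
rewrite unit_vectorE eqxx mulr1 ler_pdivrMr// => h; apply: le_trans h _.
(* The index [i] forces [n >= 1], which makes the slack between the barrier at [s *: e_ i] and its
   linear bound nonnegative. *)
have n1 : 1 <= n%:R :> R.
  by rewrite ler1n; exact: leq_trans (ltn0Sn i) (ltn_ord i).
rewrite -subr_ge0.
rewrite (_ : _ - _ = 2 * (s ^+ 2 * ((n%:R - 1) * (M / d ^+ 2) + N / 2))); last first.
  by field; rewrite gt_eqF.
rewrite mulr_ge0// mulr_ge0 ?sqr_ge0// addr_ge0 ?divr_ge0// mulr_ge0// subr_ge0.
exact: n1.
Unshelve. all: by end_near. Qed.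

End landau.

(** * Directional derivatives and functions of class C^k *)

Section growth_rate.
Context {R : realType} {V W : normedModType R}.
Implicit Types (f : V -> W) (a v : V).

Definition growth_rate f a v (h : R) : W :=
  h^-1 *: ((f \o shift a) (h *: v) - f a).

(** With the difference quotient as a function of [h], derivatives transfer along a mere equality of
    quotients. *)
Lemma is_deriveE f a v d :
  is_derive a v f d <-> growth_rate f a v h @[h --> 0^'] --> d.
Proof.
split=> [[h1 <-]|h]; first exact: h1.
by split; [apply/cvg_ex; exists d|exact: cvg_lim].
Qed.

End growth_rate.

Section directional_derivative.
Context {R : realType} {n : nat}.
Implicit Types (f g : 'rV[R]_n -> R) (x v a : 'rV[R]_n).

(** Gives access to the one-variable chain rule and mean value theorem along a line. *)
Lemma is_derive_line f x v (t d : R) :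
  is_derive t 1 (fun h : R => f (x + h *: v)) d <->
  is_derive (x + t *: v) v f d.
Proof.
have E : growth_rate (fun h : R => f (x + h *: v)) t 1 = growth_rate f (x + t *: v) v.
  apply/funext => h; congr (_ *: (f _ - _)).
  by rewrite /= scalerDl addrCA [h *: 1]mulr1.
by rewrite !is_deriveE E.
Qed.

Lemma is_derive_translate f x v a d :
  is_derive (x + a) v f d -> is_derive x v (fun y => f (y + a)) d.
Proof.
have E : growth_rate (fun y => f (y + a)) x v = growth_rate f (x + a) v.
  by apply/funext => h; rewrite /growth_rate /= addrA.
by rewrite !is_deriveE E.
Qed.

Lemma is_derive_coord (g : R -> R) (a b dg : R) x (i j : 'I_n) :
  is_derive (a * x ord0 j + b) 1 g dg ->
  is_derive x (delta_mx ord0 i) (fun x => g (a * x ord0 j + b))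
    (dg * (a * (j == i)%:R)).
Proof.
move=> dg1.
suff : is_derive (0 : R) 1 (fun h : R => g (a * (x + h *: delta_mx ord0 i) ord0 j + b))
    (dg * (a * (j == i)%:R)).
  by rewrite (is_derive_line (fun x => g (a * x ord0 j + b))) scale0r addr0.
set c : R := (j == i)%:R.
have -> : (fun h : R => g (a * (x + h *: delta_mx ord0 i) ord0 j + b)) =
    g \o (fun h => a * (c * h) + (a * x ord0 j + b)).
  apply/funext => h /=; rewrite !mxE eqxx /= -/c; congr g; ring.
apply: is_derive1_comp; first by rewrite mulr0 mulr0 add0r.
apply: is_derive_eq.
by rewrite addr0 [c%:A]mulr1.
Qed.

End directional_derivative.

(** * Closure properties of the classes [Ck] *)

Section Ck_theory.
Context {R : realType} {n : nat}.
Implicit Types (f g : 'rV[R]_n -> R) (x a : 'rV[R]_n) (i : 'I_n).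

Local Notation e_ j := (delta_mx ord0 j : 'rV[R]_n).

(** Any [dg] that is a derivative may stand for [partial i g], so closure proofs by induction can
    exhibit it explicitly. *)
Lemma CkP k g : Ck k.+1 g <->
  continuous g /\ forall i, exists2 dg, Ck k dg & forall x, is_derive x (e_ i) g (dg x).
Proof.
split=> -[cg h]; split=> // i.
  have [h1 h2] := h i; exists (partial i g) => // x.
have [dg h1 h2] := h i; split; first by move=> x; have [] := h2 x.
by have -> : partial i g = dg by apply/funext => x; exact: derive_val.
Qed.

Lemma Ck_continuous k g : Ck k g -> continuous g.
Proof. by case: k => [|k] []. Qed.

Lemma CkW k g : Ck k.+1 g -> Ck k g.
Proof.
elim: k g => [|k IH] g; first by case.
move=> /CkP[cg h]; apply/CkP; split=> // i.
by have [dg h1 h2] := h i; exists dg => //; exact: IH.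
Qed.

Lemma Ck_cst k (c : R) : Ck k (fun _ : 'rV[R]_n => c : R).
Proof.
elim: k c => [|k IH] c; first by split=> //; exact: cst_continuous.
apply/CkP; split; first exact: cst_continuous.
by move=> i; exists (fun=> 0) => // x; exact: is_derive_cst.
Qed.

Lemma CkD k f g : Ck k f -> Ck k g -> Ck k (fun x => f x + g x).
Proof.
have cD f' g' : continuous f' -> continuous g' -> continuous (fun x : 'rV[R]_n => f' x + g' x : R).
  by move=> cf cg x; apply: (@cvgD _ _ _ (nbhs x)); [exact: cf|exact: cg].
elim: k f g => [|k IH] f g; first by move=> [cf _] [cg _]; split=> //; exact: cD.
move=> /CkP[cf hf] /CkP[cg hg]; apply/CkP; split; first exact: cD.
move=> i; have [df f1 f2] := hf i; have [dg g1 g2] := hg i.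
exists (fun x => df x + dg x); first exact: IH.
by move=> x; exact: is_deriveD.
Qed.

Lemma CkM k f g : Ck k f -> Ck k g -> Ck k (fun x => f x * g x).
Proof.
have cM f' g' : continuous f' -> continuous g' -> continuous (fun x : 'rV[R]_n => f' x * g' x : R).
  by move=> cf cg x; apply: (@cvgM _ _ (nbhs x)); [exact: cf|exact: cg].
elim: k f g => [|k IH] f g; first by move=> [cf _] [cg _]; split=> //; exact: cM.
move=> Cf Cg; have /CkP[cf hf] := Cf; have /CkP[cg hg] := Cg.
apply/CkP; split; first exact: cM.
move=> i; have [df f1 f2] := hf i; have [dg g1 g2] := hg i.
exists (fun x => f x * dg x + g x * df x).
  by apply: CkD; apply: IH => //; exact: CkW.
by move=> x; exact: is_deriveM.
Qed.

Lemma Ck_prod k (I : Type) (r : seq I) (F : I -> 'rV[R]_n -> R) :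
  (forall l, Ck k (F l)) -> Ck k (fun x => \prod_(l <- r) F l x).
Proof.
move=> CF; elim: r => [|l r IH].
  by under eq_fun do rewrite big_nil; exact: Ck_cst.
by under eq_fun do rewrite big_cons; exact: CkM.
Qed.

Lemma Ck_translate k g a : Ck k g -> Ck k (fun x => g (x + a)).
Proof.
have ct f : continuous f -> continuous (fun x => f (x + a)).
  move=> cf x; apply: (@cvg_comp _ _ _ (fun y => y + a) f); last exact: cf.
  by apply: (@cvgD _ _ _ (nbhs x)); [exact: cvg_id|exact: cvg_cst].
elim: k g => [|k IH] g; first by case=> cg _; split=> //; exact: ct.
move=> /CkP[cg hg]; apply/CkP; split; first exact: ct.
move=> i; have [dg g1 g2] := hg i; exists (fun x => dg (x + a)); first exact: IH.
by move=> x; exact: is_derive_translate.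
Qed.

Lemma partial_translate i g a :
  has_partial i g -> partial i (fun x => g (x + a)) = (fun x => partial i g (x + a)).
Proof.
move=> hg; apply/funext => x; rewrite /partial.
have h : is_derive (x + a) (e_ i) g ('D_(e_ i) g (x + a)) by exact: derivableP.
by have /@derive_val := is_derive_translate h.
Qed.

Lemma laplacian_translate g a : Ck 2 g ->
  laplacian (fun x => g (x + a)) = (fun x => laplacian g (x + a)).
Proof.
move=> [cg hg]; apply/funext => x; apply: eq_bigr => i _.
have [h1 [_ h2]] := hg i; have [h3 _] := h2 i.
by rewrite !partial_translate.
Qed.

End Ck_theory.

(** * Flat functions *)

Section flat_functions.
Context {R : realType}.

(** [flat 0] is the classical smooth function flat at 0; the extra powers of [t^-1] make the linear
    span of the family closed under differentiation. *)
Definition flat (k : nat) (t : R) : R :=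
  if 0 < t then t^-1 ^+ k * expR (- t^-1) else 0.

Lemma flat_ge0 k t : 0 <= flat k t.
Proof.
rewrite /flat; case: ifPn => // t0.
by rewrite mulr_ge0 ?expR_ge0// exprn_ge0// invr_ge0 ltW.
Qed.

Lemma flat_gt0 k t : 0 < t -> 0 < flat k t.
Proof.
by move=> t0; rewrite /flat t0 mulr_gt0 ?expR_gt0// exprn_gt0// invr_gt0.
Qed.

Lemma flat0 k t : t <= 0 -> flat k t = 0.
Proof. by rewrite /flat leNgt => /negbTE ->. Qed.

Lemma flatS k t : 0 < t -> flat k.+1 t = t^-1 * flat k t.
Proof. by rewrite /flat => ->; rewrite /= exprS mulrA. Qed.

(** With [m = k + 1], [expR t^-1] is the [m]-th power of [expR (t^-1 / m)], hence at least
    [(t^-1 / m) ^+ m]. *)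
Lemma flat_le k t : flat k t <= k.+1%:R ^+ k.+1 * `|t|.
Proof.
rewrite /flat; case: ifPn => t0; last by rewrite mulr_ge0// exprn_ge0.
set m : R := k.+1%:R; have m0 : 0 < m by rewrite /m ltr0n.
rewrite gtr0_norm// expRN ler_pdivrMr ?expR_gt0//.
have -> : expR t^-1 = expR (t^-1 / m) ^+ k.+1.
  by rewrite -expRM_natl -/m mulrC divfK// gt_eqF.
apply: (@le_trans _ _ (m ^+ k.+1 * t * (t^-1 / m) ^+ k.+1)).
  rewrite expr_div_n [leRHS](_ : _ = t^-1 ^+ k)// [t^-1 ^+ k.+1]exprS.
  by field; rewrite expf_neq0 ?gt_eqF.
apply: ler_wpM2l; first by rewrite mulr_ge0 ?exprn_ge0// ltW.
apply: lerXn2r; rewrite ?nnegrE ?expR_ge0 ?divr_ge0 ?invr_ge0 ?(ltW t0)//.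
by apply: le_trans (expR_ge1Dx _); rewrite lerDr.
Qed.

(** For [t > 0], induction through [flatS] and the product rule. At 0 the right difference quotient
    of [flat k] is [flat k.+1], which tends to 0 by [flat_le]. *)
Lemma is_derive_flat (k : nat) (t : R) :
  is_derive t 1 (flat k) (flat k.+2 t - k%:R * flat k.+1 t).
Proof.
have [t0|t0|->] := ltgtP t 0.
- rewrite !flat0 ?(ltW t0)// mulr0 subr0.
  have := is_derive_cst (0 : R) t (1 : R); apply: near_eq_is_derive.
  by near=> s; rewrite flat0//; near: s; exact: lt_le_nbhsl.
- have dV : is_derive t 1 (fun s : R => s^-1) (- t ^- 2).
    have := @is_deriveV R id t 1 1 (lt0r_neq0 t0) (is_derive_id _ _).
    by rewrite [_ *: 1]mulr1.
  elim: k => [|k IH].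
    have dN : is_derive t 1 (fun s : R => - s^-1) (t ^- 2).
      by have := is_deriveN dV; rewrite opprK.
    have := is_derive1_comp (g := fun s => - s^-1) (is_derive_expR (- t^-1)) dN.
    rewrite mul0r subr0 mulrC -exprVn [X in is_derive _ _ _ X](_ : _ = flat 2 t).
      apply: near_eq_is_derive.
      near=> s; rewrite /flat ifT ?expr0 ?mul1r//; near: s; exact: lt_nbhsr.
    by rewrite /flat t0.
  have := is_deriveM dV IH.
  rewrite [X in is_derive _ _ _ X](_ : _ = flat k.+3 t - k.+1%:R * flat k.+2 t).
    apply: near_eq_is_derive.
    near=> s; rewrite flatS//; near: s; exact: lt_nbhsr.
  by rewrite /GRing.scale /= !(flatS _ t0) -exprVn -[k.+1%:R]natr1; ring.
- rewrite !flat0// mulr0 subr0.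
  apply/is_deriveE; rewrite /growth_rate.
  have c0 (c : R) : c * `|h| @[h --> (0 : R)^'] --> (0 : R).
    have : c * `|h| @[h --> (0 : R)] --> c * `|0 : R|.
      by apply: (@cvgMl_tmp _ _ (nbhs (0 : R))); exact: norm_continuous.
    by rewrite normr0 mulr0 => /(_ _ _)/cvg_within_filter; apply.
  (* The constant of [flat_le] at index [k.+1]. *)
  pose c : R := k.+2%:R ^+ k.+2.
  apply: (squeeze_cvgr (f := fun h => - c * `|h|) (h := fun h => c * `|h|)) => //.
  apply: nearW => h; rewrite mulNr -ler_norml /= addr0 [h *: 1]mulr1 [in flat k 0]flat0// subr0.
  have [h0|h0] := leP h 0.
    by rewrite flat0// scaler0 normr0 mulr_ge0// exprn_ge0.
  by rewrite [_ *: _](esym (flatS k h0)) ger0_norm ?flat_ge0// flat_le.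
Unshelve. all: by end_near. Qed.

Lemma continuous_flat k : continuous (flat k).
Proof.
move=> t; apply: differentiable_continuous; apply/derivable1_diffP.
by have [] := is_derive_flat k t.
Qed.

Lemma Ck_flat n m k (a b : R) (j : 'I_n) :
  Ck m (fun x : 'rV[R]_n => flat k (a * x ord0 j + b)).
Proof.
have c l : continuous (fun x : 'rV[R]_n => flat l (a * x ord0 j + b)).
  move=> x; apply: (@cvg_comp _ _ _ (fun y : 'rV[R]_n => a * y ord0 j + b) (flat l));
    last exact: continuous_flat.
  apply: (@cvgD _ _ _ (nbhs x)); last exact: cvg_cst.
  by apply: (@cvgMl_tmp _ _ (nbhs x)); exact: coord_continuous.
elim: m k => [|m IH] k; first by split.
apply/CkP; split=> // i.
exists (fun x => (flat k.+2 (a * x ord0 j + b) + (- k%:R) * flat k.+1 (a * x ord0 j + b)) *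
    (a * (j == i)%:R)).
  apply: CkM; last exact: Ck_cst.
  by apply: CkD => //; apply: CkM => //; exact: Ck_cst.
move=> x; rewrite mulNr; apply: is_derive_coord; exact: is_derive_flat.
Qed.

End flat_functions.

(** * Integration on R^n *)

Section integration_Rn.
Context {R : realType}.

Local Notation mR := (measurableTypeR R).

Lemma mx_coord_le n (x : 'rV[R]_n) j : `|x ord0 j| <= `|x|.
Proof.
by rewrite [leRHS]/Num.norm/= mx_normrE; exact: (le_bigmax _ _ (ord0, j)).
Qed.

Lemma mx_norm_leP n (x : 'rV[R]_n) (r : R) : 0 <= r ->
  (forall j, `|x ord0 j| <= r) <-> `|x| <= r.
Proof.
move=> r0; split=> [h|h j]; last exact: le_trans (mx_coord_le _ _) h.
rewrite [leLHS]/Num.norm/= mx_normrE; apply/bigmax_leP; split=> //= -[i j] _.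
by rewrite (ord1 i).
Qed.

(** Measurability lives on tuples and continuity on row vectors. Rounding down to the grid of mesh
    [1 / (k + 1)] links them: the rounded functions take countably many values on measurable cells
    and converge pointwise to [F]. *)
Lemma measurable_continuous_row n (F : 'rV[R]_n -> R) : continuous F ->
  measurable_fun [set: n.-tuple mR] (fun t => F (\row_i tnth t i)).
Proof.
move=> cF.
pose q k (z : n.-tuple int) : 'rV[R]_n := \row_i ((tnth z i)%:~R / k.+1%:R).
pose fl k (t : n.-tuple mR) : n.-tuple int :=
  [tuple Num.floor (k.+1%:R * tnth t i : R) | i < n].
apply: (@measurable_fun_cvg _ _ _ _
  (fun k (t : n.-tuple mR) => F (q k (fl k t)))).
- move=> k _ Y mY; rewrite setTI.
  have -> : (fun t => F (q k (fl k t))) @^-1` Y =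
      \bigcup_(z : n.-tuple int) [set t | fl k t = z /\ Y (F (q k z))].
    apply/seteqP; split => [t Yt|t [z _ [<-]]//]; by exists (fl k t).
  apply: countable_bigcupT_measurable; first exact: countableP.
  move=> z; have [Yz|nYz] := pselect (Y (F (q k z))); last first.
    rewrite (_ : [set _ | _] = set0); first exact: measurable0.
    by apply/seteqP; split => // t [].
  rewrite (_ : [set _ | _] = \bigcap_(i in [set: 'I_n])
     ((fun t : n.-tuple mR => tnth t i) @^-1`
       ((fun s : mR => k.+1%:R * s) @^-1` `[(tnth z i)%:~R, (tnth z i + 1)%:~R[))).
    apply: fin_bigcap_measurable => // i _; rewrite -[X in measurable X]setTI.
    apply: measurable_tnth => //; rewrite -[X in measurable X]setTI.
    by apply: (@mulrl_measurable R setT k.+1%:R) => //; exact: measurable_itv.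
  apply/seteqP; split => [t [<- _] i _ /=|t tz /=].
    by rewrite tnth_mktuple in_itv/=; exact: floor_itv.
  split => //; apply: eq_from_tnth => i; rewrite tnth_mktuple.
  by apply: floor_def; have := tz i I; rewrite /= in_itv.
- move=> t _; apply: (@cvg_comp _ _ _ (fun k => q k (fl k t)) F); last exact: cF.
  apply/cvgrPdist_le => e e0; near=> k.
  apply/mx_norm_leP; first exact: ltW.
  move=> j; rewrite !mxE tnth_mktuple.
  have k0 : 0 < k.+1%:R :> R by rewrite ltr0n.
  have := floor_itv (k.+1%:R * tnth t j : R); set z := Num.floor _.
  rewrite intrD mulr1z => /andP[h1 h2].
  have -> : tnth t j - z%:~R / k.+1%:R = (k.+1%:R * tnth t j - z%:~R) / k.+1%:R.
    by rewrite mulrBl mulrAC mulfV ?mul1r// gt_eqF.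
  rewrite normrM.
  rewrite [X in _ * X]gtr0_norm ?invr_gt0//.
  apply: (@le_trans _ _ (1 * k.+1%:R^-1)).
    by rewrite ler_wpM2r ?invr_ge0 ?(ltW k0)// ler_norml; apply/andP; split; lra.
  rewrite mul1r; apply: ltW; near: k; exact: (near_infty_natSinv_lt (PosNum e0)).
Unshelve. all: by end_near. Qed.

(** * Integrals of continuous functions with bounded support *)

Section bounded_support.
Context {n : nat}.
Implicit Types (F G : 'rV[R]_n -> R) (a : 'rV[R]_n) (r C : R).

(** Vanishing outside a ball is easier to propagate than compactness of a closure. The radius may be
    negative, whence the absolute values around it in the proofs. *)
Definition bounded_support F := exists r, forall y, r < `|y| -> F y = 0.

Lemma bounded_support_bounded F : continuous F -> bounded_support F ->
  exists2 C, 0 < C & forall y, `|F y| <= C.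
Proof.
move=> cF [r F0].
pose Q := [set y : 'rV[R]_n | forall j, y ord0 j \in `[- `|r|, `|r|]].
have cQ : compact Q.
  apply: (@rV_compact _ _ (fun=> `[- `|r|, `|r|]%classic)) => j.
  exact: segment_compact.
have /compact_bounded/ex_strict_bound_gt0[C C0 FC] : compact (F @` Q).
  by apply: continuous_compact => //; exact: continuous_subspaceT.
exists C => // y; have [yr|yr] := leP `|y| `|r|; last first.
  by rewrite F0 ?normr0 ?(ltW C0)// (le_lt_trans (ler_norm r)).
apply/ltW/FC; exists y => // j.
by rewrite in_itv/= -ler_norml; exact: le_trans (mx_coord_le _ _) yr.
Qed.

(** The norm on row vectors is the sup norm, so this is its closed ball seen on tuples, of measure
    [(2 * r) ^+ n]. *)
Definition box (x : 'rV[R]_n) r : set (n.-tuple mR) :=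
  [set t | forall i, `[x ord0 i - r, x ord0 i + r]%classic (tnth t i)].

Lemma mem_box x r t : 0 <= r -> box x r t <-> `|\row_i tnth t i - x| <= r.
Proof.
move=> r0; split=> [h|/(mx_norm_leP _ r0) h i].
  by apply/mx_norm_leP => // i; have := h i; rewrite /= in_itv/= !mxE ler_distl.
by have := h i; rewrite /= in_itv/= !mxE ler_distl.
Qed.

Lemma notin_box x r t : 0 <= r -> t \notin box x r -> r < `|\row_i tnth t i - x|.
Proof.
move=> r0; rewrite notin_setE ltNge => nb; apply/negP => h.
by apply: nb; exact/mem_box.
Qed.

Lemma measurable_box x r : measurable (box x r).
Proof.
rewrite (_ : box x r = \bigcap_(i in [set: 'I_n])
    ((fun t : n.-tuple mR => tnth t i) @^-1` `[x ord0 i - r, x ord0 i + r])).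
  apply: fin_bigcap_measurable => // i _; rewrite -[X in measurable X]setTI.
  by apply: measurable_tnth => //; exact: measurable_itv.
by apply/seteqP; split=> [t At i _|t At i]; apply: At.
Qed.

Lemma lebesgue_Rn_ball x r : 0 <= r ->
  lebesgue_Rn n (box x r) = ((2 * r) ^+ n)%:E.
Proof.
move=> r0; rewrite /box (@lebesgue_Rn_box _ _ (fun i => `[x ord0 i - r, x ord0 i + r]%classic)).
  rewrite (eq_bigr (fun=> (2 * r)%:E)); last first.
    move=> i _; rewrite lebesgue_measure_itv/= lte_fin; case: ifPn => [_|].
      by rewrite -EFinB; congr EFin; ring.
    by rewrite -leNgt => h; congr EFin; lra.
  by rewrite prodEFin prodr_const card_ord.
by move=> i; exact: measurable_itv.
Qed.

Lemma integrable_box x r (f : n.-tuple mR -> R) C : 0 <= r ->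
  measurable_fun setT f -> (forall t, `|f t| <= C) ->
  (lebesgue_Rn n).-integrable setT (EFin \o f \_ (box x r)).
Proof.
move=> r0 mf fC; rewrite -restrict_EFin.
have mB := measurable_box x r.
apply/(integrable_mkcond _ mB); apply: measurable_bounded_integrable => //.
- rewrite [X in (X < _)%E](_ : _ = ((2 * r) ^+ n)%:E) ?ltry//.
  exact: lebesgue_Rn_ball.
- exact: measurable_funS mf.
- exists C; split; first exact: num_real.
  by move=> c Cc t _ /=; rewrite (le_trans (fC t))// ltW.
Qed.

Lemma integrable_Rn F : continuous F -> bounded_support F ->
  (lebesgue_Rn n).-integrable setT (EFin \o (fun t => F (\row_i tnth t i))).
Proof.
move=> cF sF; have [C _ FC] := bounded_support_bounded cF sF.
case: sF => r F0; pose f (t : n.-tuple mR) := F (\row_i tnth t i).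
rewrite (_ : (fun t => F _) = f \_ (box 0 `|r|)).
  apply: (@integrable_box _ _ _ C) => //; first exact: measurable_continuous_row.
  by move=> t; exact: FC.
apply/funext => t; rewrite patchE; case: ifPn => // /(notin_box (normr_ge0 r)).
rewrite subr0 => h.
by rewrite F0// (le_lt_trans (ler_norm r)).
Qed.

Lemma integral_box_cst x r C : 0 <= r ->
  \int[lebesgue_Rn n]_t ((cst C) \_ (box x r)) t = C * (2 * r) ^+ n.
Proof.
move=> r0; rewrite -Rintegral_mkcond Rintegral_cst; last exact: measurable_box.
by congr (_ * _); rewrite [X in fine X](_ : _ = ((2 * r) ^+ n)%:E)//; exact: lebesgue_Rn_ball.
Qed.

Lemma integral_Rn_le_ball F x r C : continuous F -> 0 <= r -> 0 <= C ->
  (forall y, F y <= C) -> (forall y, r < `|y - x| -> F y = 0) ->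
  bounded_support F -> integral_Rn F <= C * (2 * r) ^+ n.
Proof.
move=> cF r0 C0 FC F0 sF; rewrite -(integral_box_cst x)//.
apply: le_Rintegral => //; first exact: integrable_Rn.
  by apply: (@integrable_box _ _ _ C) => // t; rewrite ger0_norm.
move=> t _; rewrite patchE; case: ifPn => [_|]; first exact: FC.
by move=> /(notin_box r0)/F0 ->.
Qed.

Lemma integral_Rn_ge_ball F x r C : continuous F -> 0 <= r -> 0 <= C ->
  (forall y, 0 <= F y) -> (forall y, `|y - x| <= r -> C <= F y) ->
  bounded_support F -> C * (2 * r) ^+ n <= integral_Rn F.
Proof.
move=> cF r0 C0 FC F0 sF; rewrite -(integral_box_cst x)//.
apply: le_Rintegral => //; last first.
- move=> t _; rewrite patchE; case: ifPn => [|_]; last exact: FC.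
  by rewrite inE => /(mem_box _ _ r0)/F0.
- exact: integrable_Rn.
- by apply: (@integrable_box _ _ _ C) => // t; rewrite ger0_norm.
Qed.

Lemma integral_RnB F G : continuous F -> bounded_support F ->
  continuous G -> bounded_support G ->
  integral_Rn (fun y => F y - G y) = integral_Rn F - integral_Rn G.
Proof.
by move=> cF bF cG bG; apply: RintegralB => //; exact: integrable_Rn.
Qed.

Lemma integral_RnD F G : continuous F -> bounded_support F ->
  continuous G -> bounded_support G ->
  integral_Rn (fun y => F y + G y) = integral_Rn F + integral_Rn G.
Proof.
by move=> cF bF cG bG; apply: RintegralD => //; exact: integrable_Rn.
Qed.

Lemma integral_RnZ c F : continuous F -> bounded_support F ->
  integral_Rn (fun y => c * F y) = c * integral_Rn F.
Proof. by move=> cF bF; apply: RintegralZl => //; exact: integrable_Rn. Qed.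

Lemma le_integral_Rn F G : continuous F -> bounded_support F ->
  continuous G -> bounded_support G -> (forall y, F y <= G y) ->
  integral_Rn F <= integral_Rn G.
Proof.
by move=> cF bF cG bG h; apply: le_Rintegral => //; exact: integrable_Rn.
Qed.

Lemma normr_integral_Rn F : continuous F -> bounded_support F ->
  `|integral_Rn F| <= integral_Rn (fun y => `|F y|).
Proof. by move=> cF bF; apply: le_normr_Rintegral => //; exact: integrable_Rn. Qed.

Lemma normr_integral_Rn_ball F x r C : continuous F -> 0 <= r ->
  (forall y, `|F y| <= C) -> (forall y, r < `|y - x| -> F y = 0) ->
  `|integral_Rn F| <= C * (2 * r) ^+ n.
Proof.
move=> cF r0 FC F0.
have sF : bounded_support F.
  exists (r + `|x|) => y h; apply: F0.
  by have := ler_normD (y - x) x; rewrite subrK; lra.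
apply: le_trans (normr_integral_Rn cF sF) _.
apply: (integral_Rn_le_ball (x := x)) => //.
- by move=> y; apply: (@continuous_comp _ _ _ F Num.norm); [exact: cF|exact: norm_continuous].
- exact: le_trans (FC 0).
- by move=> y /F0 ->; rewrite normr0.
- by case: sF => s Fs; exists s => y /Fs ->; rewrite normr0.
Qed.

End bounded_support.

(** * Translation invariance of Lebesgue measure *)

Lemma lebesgue_measure_translate (a : R) (A : set mR) : measurable A ->
  pushforward lebesgue_measure (fun x : mR => (x + a : R) : mR) A = lebesgue_measure A.
Proof.
move=> mA.
have ma : measurable_fun setT (fun x : mR => (x + a : mR)).
  by apply: measurable_funD => //; exact: measurable_cst.
pose nu : {measure set mR -> \bar R} :=
  measure_function_pushforward__canonical__measure_function_Measure lebesgue_measure ma.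
(* By uniqueness it suffices to compare the two measures on half-open intervals. *)
apply/esym; apply: (@lebesgue_measure_unique R nu) => // _ [[u v]] _ <-.
rewrite /nu /= /pushforward /=.
rewrite (_ : _ @^-1` _ = `](u - a), (v - a)]%classic); last first.
  by apply/seteqP; split => x /=; rewrite !in_itv/= => /andP[? ?]; apply/andP; split; lra.
rewrite !lebesgue_measure_itv/= !lte_fin ltrD2r; case: ifP => // _.
by rewrite -!EFinB; congr EFin; ring.
Qed.

Definition translate_tuple n (a t : n.-tuple mR) : n.-tuple mR :=
  [tuple (tnth t i + tnth a i : R) | i < n].

Lemma measurable_translate_tuple n (a : n.-tuple mR) :
  measurable_fun setT (translate_tuple a).
Proof.
apply/measurable_fun_tnthP => i.
rewrite (_ : _ \o _ = (fun t : n.-tuple mR => (tnth t i + tnth a i : R))).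
  by apply: measurable_funD; [exact: measurable_tnth|exact: measurable_cst].
by apply/funext => t /=; rewrite tnth_mktuple.
Qed.

(** Induction on the dimension: the section at [x] of the preimage is a translated section of [A] at
    [x + a0], so the inner measure is invariant by induction and the outer integral by the
    one-dimensional case. *)
Lemma lebesgue_Rn_translate n (a : n.-tuple mR) (A : set (n.-tuple mR)) :
  measurable A -> lebesgue_Rn n (translate_tuple a @^-1` A) = lebesgue_Rn n A.
Proof.
elim: n a A => [|n IH] a A mA.
  rewrite (_ : translate_tuple a = id)//; apply/funext => t.
  by rewrite (tuple0 t) (tuple0 (translate_tuple _ _)).
case/tupleP: a => a0 a.
have mC B : measurable B -> measurable (@cons_pair R n @^-1` B).
  by move=> mB; rewrite -[X in measurable X]setTI; exact: measurable_cons_pair.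
have e (x : mR) t : translate_tuple [tuple of a0 :: a] (cons_pair (x, t)) =
    cons_pair ((x + a0 : R) : mR, translate_tuple a t).
  apply: eq_from_tnth => i; rewrite tnth_mktuple /cons_pair /=.
  by case: (unliftP ord0 i) => [j ->|->]; rewrite ?tnthS ?tnth0 ?tnth_mktuple.
pose G (x : mR) := lebesgue_Rn n (xsection (@cons_pair R n @^-1` A) x).
have E (x : mR) : lebesgue_Rn n (xsection (@cons_pair R n @^-1`
    (translate_tuple [tuple of a0 :: a] @^-1` A)) x) = G (x + a0 : R).
  rewrite /G -[RHS](IH a); last exact: measurable_xsection (mC _ mA).
  congr (lebesgue_Rn n _); apply/seteqP.
  by split => t; rewrite /xsection /= !inE /= e.
have ma : measurable_fun setT (fun x : mR => (x + a0 : mR)).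
  by apply: measurable_funD => //; exact: measurable_cst.
rewrite /= /lebesgue_cons /pushforward /= /product_measure1.
transitivity (\int[@lebesgue_measure R]_x G ((x : R) + a0)%R)%E.
  by apply: eq_integral => x _; rewrite /= E.
pose sh (x : mR) : mR := (x : R) + a0.
transitivity (\int[pushforward lebesgue_measure sh]_x G x)%E.
  rewrite (ge0_integral_pushforward ma)//.
  by apply: measurable_fun_xsection; exact: mC.
by apply: eq_measure_integral => B mB _; exact: lebesgue_measure_translate.
Qed.

(** Serves to give every translate of a mollifier mass 1. Nonnegativity allows the change of
    variables in the extended reals. *)
Lemma integral_Rn_translate n (F : 'rV[R]_n -> R) (a : 'rV[R]_n) :
  continuous F -> (forall y, 0 <= F y) ->
  integral_Rn (fun y => F (y + a)) = integral_Rn F.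
Proof.
move=> cF F0.
pose a' : n.-tuple mR := [tuple a ord0 i | i < n].
pose f (t : n.-tuple mR) := (F (\row_i tnth t i))%:E.
have mf : measurable_fun setT f.
  by apply/measurable_EFinP; exact: measurable_continuous_row.
congr fine; transitivity (\int[lebesgue_Rn n]_t (f \o translate_tuple a') t)%E.
  apply: eq_integral => t _; rewrite /f /=; congr (F _)%:E.
  by apply/rowP => i; rewrite !mxE !tnth_mktuple.
transitivity (\int[pushforward (lebesgue_Rn n) (translate_tuple a')]_t f t)%E.
  rewrite (ge0_integral_pushforward (measurable_translate_tuple a'))//.
  by move=> y _; rewrite lee_fin.
apply: eq_measure_integral => [|ma B mB _]; first exact: measurable_translate_tuple.
exact: lebesgue_Rn_translate.
Qed.

End integration_Rn.

(** * Increments of functions of class C^2 *)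

Section increments.
Context {R : realType} {n : nat}.
Implicit Types (f w : 'rV[R]_n -> R) (x p v : 'rV[R]_n) (i : 'I_n).

Local Notation e_ j := (delta_mx ord0 j : 'rV[R]_n).

Lemma is_derive_epsP (f : 'rV[R]_n -> R) x v (d : R) : is_derive x v f d <->
  forall e, 0 < e -> exists2 r, 0 < r &
    forall h, `|h| < r -> `|f (x + h *: v) - f x - h * d| <= e * `|h|.
Proof.
rewrite is_deriveE; split=> [/cvgrPdist_le H e e0|H].
  have /nbhs_ballP[r /= r0 rH] := H e e0; exists r => // h hr.
  have [->|h0] := eqVneq h 0.
    by rewrite scale0r addr0 subrr mul0r subrr !normr0 mulr0.
  have := rH h; rewrite /ball/= sub0r normrN => /(_ hr h0).
  rewrite /growth_rate /= [_ *: _]/(_^-1 * _) -(ler_pM2l (_ : 0 < `|h|)) ?normr_gt0//.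
  rewrite -normrM mulrBr mulrA mulfV// mul1r distrC [h *: v + x]addrC.
  by rewrite [X in _ <= X]mulrC.
apply/cvgrPdist_le => e e0; have [r r0 rH] := H e e0.
apply/nbhs_ballP; exists r => // h /=; rewrite /ball/= sub0r normrN => hr h0.
rewrite /growth_rate /= [_ *: _]/(_^-1 * _) -(ler_pM2l (_ : 0 < `|h|)) ?normr_gt0//.
rewrite -normrM mulrBr mulrA mulfV// mul1r distrC [h *: v + x]addrC.
by rewrite [X in _ <= X]mulrC; exact: rH.
Qed.

Lemma derive_continuous1 (g dg : R -> R) :
  (forall t : R, is_derive t 1 g (dg t)) -> continuous g.
Proof.
move=> h t; apply: differentiable_continuous; apply/derivable1_diffP.
by have [] := h t.
Qed.

Lemma directional_MVT f v (df : 'rV[R]_n -> R) x (h : R) :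
  (forall x, is_derive x v f (df x)) ->
  exists2 c, `|c| <= `|h| & f (x + h *: v) - f x = h * df (x + c *: v).
Proof.
move=> fdf.
have line y (t : R) : is_derive t 1 (fun s : R => f (y + s *: v)) (df (y + t *: v)).
  by apply/is_derive_line; exact: fdf.
have pos y (t : R) : 0 <= t ->
    exists2 c, 0 <= c <= t & f (y + t *: v) - f y = t * df (y + c *: v).
  move=> t0.
  have [c ct /= fc] := MVT_segment t0 (fun s _ => line y s)
    (continuous_subspaceT (derive_continuous1 (line y))).
  exists c; first by move: ct; rewrite in_itv.
  by move: fc; rewrite scale0r addr0 subr0 mulrC.
have [h0|h0] := leP 0 h.
  have [c /andP[c0 ch] E] := pos x h h0.
  by exists c => //; rewrite !ger0_norm.
(* For [h < 0] the segment is run backwards from its other endpoint. *)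
have [|c /andP[c0 ch] E] := pos (x + h *: v) (- h); first by lra.
exists (h + c); first by rewrite (ltr0_norm h0) ler0_norm; lra.
by rewrite scalerDl addrA; move: E; rewrite scaleNr addrK; lra.
Qed.

(** Mean value theorem for [g], the symmetric sum minus [t ^+ 2 * L]: its derivative at [c] is
    controlled by the first-order expansion of [df] at [p], with error [eta / 2 * c] on each
    side. *)
Lemma second_difference_derive f v (df : 'rV[R]_n -> R) p (L eta : R) :
  (forall x, is_derive x v f (df x)) -> is_derive p v df L ->
  0 < eta -> \forall t \near 0^'+,
    `|f (p + t *: v) + f (p - t *: v) - 2 * f p - t ^+ 2 * L| <= eta * t ^+ 2.
Proof.
move=> fdf /is_derive_epsP pdL eta0; move: pdL => /(_ _ (divr_gt0 eta0 (@ltr0Sn R 1)))[r r0 dL].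
pose g (t : R) := f (p + t *: v) + f (p - t *: v) - t ^+ 2 * L.
pose dg (t : R) := df (p + t *: v) - df (p - t *: v) - 2 * t * L.
have gdg (t : R) : is_derive t 1 g (dg t).
  have d1 : is_derive t 1 (fun s : R => f (p + s *: v)) (df (p + t *: v)).
    by apply/is_derive_line; exact: fdf.
  have d2 : is_derive t 1 (fun s : R => f (p - s *: v)) (- df (p - t *: v)).
    have h : is_derive (- t) 1 (fun s : R => f (p + s *: v)) (df (p + (- t) *: v)).
      by apply/is_derive_line; exact: fdf.
    have := is_derive1_comp (g := fun s => - s) h (is_deriveNid t 1).
    rewrite mulrN1 scaleNr; congr (is_derive _ _ _ _).
    by apply/funext => s /=; rewrite scaleNr.
  have d3 : is_derive t 1 (fun s : R => s ^+ 2 * L) (2 * t * L).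
    have := is_deriveM (is_deriveM (is_derive_id t (1 : R)) (is_derive_id t (1 : R)))
      (is_derive_cst L t (1 : R)).
    rewrite [X in is_derive _ _ X _ -> _](_ : _ = (fun s => s ^+ 2 * L))//.
    rewrite [X in is_derive _ _ _ X -> _](_ : _ = 2 * t * L)//.
    by rewrite /GRing.scale /=; ring.
  exact: (is_deriveB (is_deriveD d1 d2) d3).
near=> t.
have t0 : 0 < t by [].
have tr : t < r by near: t; exact: nbhs_right_lt.
have [c ct E] := MVT_segment (ltW t0) (fun s _ => gdg s)
    (continuous_subspaceT (derive_continuous1 gdg)).
have {ct} /andP[c0 ct] : 0 <= c <= t by move: ct; rewrite in_itv.
have -> : f (p + t *: v) + f (p - t *: v) - 2 * f p - t ^+ 2 * L = t * dg c.
  move: E; rewrite subr0 [dg c * t]mulrC => <-; rewrite /g !scale0r subr0 addr0 expr0n/=; ring.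
rewrite normrM gtr0_norm//.
have h1 := dL c; rewrite ger0_norm// in h1; have {}h1 := h1 (le_lt_trans ct tr).
have h2 := dL (- c); rewrite normrN ger0_norm// scaleNr in h2; have {}h2 := h2 (le_lt_trans ct tr).
have -> : eta * t ^+ 2 = t * (eta * t) by ring.
rewrite ler_pM2l// /dg.
apply: (@le_trans _ _ (eta * c)); last by rewrite ler_pM2l.
have -> : df (p + c *: v) - df (p - c *: v) - 2 * c * L =
   (df (p + c *: v) - df p - c * L) - (df (p - c *: v) - df p - (- c) * L) by ring.
by apply: le_trans (ler_normB _ _) _; lra.
Unshelve. all: by end_near. Qed.

Lemma second_difference_laplacian w p (N : R) : Ck 2 w -> `|laplacian w p| < N ->
  \forall t \near 0^'+, `|second_difference w t p| < N * t ^+ 2.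
Proof.
move=> Cw wN; have [_ hw] := Cw.
have [n0|n0] := posnP n.
  near=> t; rewrite /second_difference big1 ?normr0; last first.
    by move=> j; have := ltn_ord j; rewrite [X in (_ < X)%N]n0.
  by rewrite mulr_gt0 ?exprn_gt0// (le_lt_trans _ wN).
(* The [n] directional errors together use half the gap below [N]; the division by [n] is why
   [n = 0] is treated apart. *)
pose eta := (N - `|laplacian w p|) / (2 * n%:R).
have nR0 : 0 < n%:R :> R by rewrite ltr0n.
have eta0 : 0 < eta by rewrite divr_gt0 ?mulr_gt0// subr_gt0.
have /= H : \forall t \near (0 : R)^'+, forall j,
   `|w (p + t *: e_ j) + w (p - t *: e_ j) - 2 * w p - t ^+ 2 * partial j (partial j w) p|
     <= eta * t ^+ 2.
  apply: filter_forall => j; have [h1 [_ h2]] := hw j; have [h3 _] := h2 j.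
  by apply: (second_difference_derive (df := partial j w)) => //; move=> x; exact: derivableP.
near=> t; have t0 : 0 < t by [].
have Ht := near H t.
rewrite -[second_difference w t p](subrK (t ^+ 2 * laplacian w p)).
apply: le_lt_trans (ler_normD _ _) _.
apply: (@le_lt_trans _ _ (n%:R * (eta * t ^+ 2) + t ^+ 2 * `|laplacian w p|)).
  apply: lerD; last by rewrite normrM ger0_norm// exprn_ge0// ltW.
  rewrite /second_difference /laplacian mulr_sumr -sumrB.
  apply: le_trans (ler_norm_sum _ _ _) _.
  apply: (@le_trans _ _ (\sum_(j < n) (eta * t ^+ 2))); last first.
    by rewrite sumr_const card_ord mulr_natl.
  by apply: ler_sum => j _; apply: Ht.
rewrite (_ : n%:R * _ + _ = (N + `|laplacian w p|) / 2 * t ^+ 2); last first.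
  by rewrite /eta; field; rewrite gt_eqF.
rewrite ltr_pM2r ?exprn_gt0//; lra.
Unshelve. all: by end_near. Qed.

(** The symmetric estimate is applied at the midpoint of the segment with [s = |h| / 2], to [w] and
    to [- w]. *)
Lemma increment_le w (M N d : R) i x h : Ck 2 w ->
  (forall y, `|w y| <= M) -> (forall y, `|laplacian w y| < N) ->
  0 < d -> `|h| <= 2 * d ->
  `|w (x + h *: e_ i) - w x| <= `|h| * (n%:R * M / d + N * d / 2).
Proof.
move=> Cw wM wN d0 hd.
have cw := Ck_continuous Cw.
pose s := `|h| / 2.
have sd : 0 <= s <= d by apply/andP; rewrite /s; have := normr_ge0 h; split; lra.
have H y : `|w (y + s *: e_ i) - w (y - s *: e_ i)| <=
     `|h| * (n%:R * M / d + N * d / 2).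
  have -> : `|h| = 2 * s by rewrite /s; field.
  rewrite ler_norml lerNl opprB; apply/andP; split; last first.
    by apply: symmetric_increment_le => // p; exact: second_difference_laplacian.
  have : (fun y => - w y) (y + s *: e_ i) - (fun y => - w y) (y - s *: e_ i) <=
      2 * s * (n%:R * M / d + N * d / 2).
    apply: (@symmetric_increment_le _ _ (fun y => - w y)) => //.
    - by move=> z; apply: continuousN; exact: cw.
    - by move=> z; rewrite normrN.
    - move=> p; have := second_difference_laplacian Cw (wN p).
      apply: filterS => t; congr (_ < _); rewrite -normrN; congr (Num.norm _).
      by rewrite /second_difference -sumrN; apply: eq_bigr => j _; ring.
  by rewrite opprK addrC.
have [h0|h0] := leP 0 h.
  have := H (x + s *: e_ i); rewrite addrK -addrA -scalerDl.
  by rewrite (_ : s + s = h)// /s ger0_norm//; field.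
have := H (x - s *: e_ i); rewrite subrK -addrA -opprD -scalerDl -scaleNr distrC.
by rewrite (_ : - (s + s) = h)// /s ltr0_norm//; field.
Qed.

End increments.

(** * Convolution with compactly supported functions *)

Section convolution.
Context {R : realType} {n : nat}.
Implicit Types (g phi psi : 'rV[R]_n -> R) (x y a v : 'rV[R]_n) (i : 'I_n).

Local Notation e_ j := (delta_mx ord0 j : 'rV[R]_n).

Lemma bounded_support_unif_continuous phi (e : R) :
  continuous phi -> bounded_support phi -> 0 < e ->
  exists2 r, 0 < r & forall y z, `|z| < r -> `|phi (y + z) - phi y| <= e.
Proof.
move=> cphi [s phi0] e0.
(* The margin 1, together with [r < 1], puts both [y] and [y + z] outside the support when [y] is
   not in [Q]. *)
pose Q := [set y : 'rV[R]_n | forall j, y ord0 j \in `[- (`|s| + 1), `|s| + 1]].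
have cQ : compact Q.
  apply: (@rV_compact _ _ (fun=> `[- (`|s| + 1), `|s| + 1]%classic)) => j.
  exact: segment_compact.
have /compact_near_coveringP/(_ R (0 : R)^'+
    (fun r y => forall z, `|z| < r -> `|phi (y + z) - phi y| <= e)) H := cQ.
have /H H' : forall y, Q y -> \forall y' \near y & r \near (0 : R)^'+,
    forall z, `|z| < r -> `|phi (y' + z) - phi y'| <= e.
  move=> y _; have e20 : 0 < e / 2 by rewrite divr_gt0.
  have /cvgrPdist_le/(_ _ e20)/nbhs_ballP[r /= r0 yr] := cphi y.
  have r20 : 0 < r / 2 by rewrite divr_gt0.
  exists (ball y (r / 2), [set t | t < r / 2]) => /=.
    by split; [exact: nbhsx_ballx|exact: nbhs_right_lt].
  move=> [y' t] /= [yy' tr] z zt.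
  have yy'2 : `|y - y'| < r / 2 by rewrite -ball_normE in yy'.
  have h1 : `|phi y - phi y'| <= e / 2.
    by apply: yr; rewrite -ball_normE /ball_/=; lra.
  have h2 : `|phi y - phi (y' + z)| <= e / 2.
    apply: yr; rewrite -ball_normE /ball_/= opprD addrA.
    by apply: le_lt_trans (ler_normB _ _) _; lra.
  rewrite -[_ - _](subrKA (phi y)).
  by apply: le_trans (ler_normD _ _) _; rewrite [X in X + _]distrC; lra.
have [r /= [[rQ r1] r0]] := @filter_ex _ (0 : R)^'+ _ _
  (filterI (filterI H' (nbhs_right_lt (@ltr01 R))) (@nbhs_right_gt R 0)).
exists r => // y z zr.
have [yQ|nyQ] := pselect (Q y); first exact: rQ.
have ys : `|s| + 1 < `|y|.
  rewrite ltNge; apply/negP => h; apply: nyQ => j.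
  by rewrite in_itv/= -ler_norml; exact: le_trans (mx_coord_le _ _) h.
have ss := ler_norm s.
rewrite !phi0 ?subrr ?normr0 ?(ltW e0)//; first by lra.
by have := lerB_normD y z; lra.
Qed.

Definition Cc phi := continuous phi /\ bounded_support phi.

Lemma Cc_translate phi a : Cc phi -> Cc (fun y => phi (y + a)).
Proof.
move=> [cp [r h]]; split.
  by apply: (@Ck_continuous _ _ 0); apply: Ck_translate; split.
by exists (r + `|a|) => y yr; apply: h; have := lerB_normD y a; lra.
Qed.

Lemma Cc_mul g phi : continuous g -> Cc phi -> Cc (fun y => g y * phi y).
Proof.
move=> cg [cp [r h]]; split; last by exists r => y /h ->; rewrite mulr0.
by apply: (@Ck_continuous _ _ 0); apply: CkM; split.
Qed.

Lemma Cc_scale (c : R) phi : Cc phi -> Cc (fun y => c * phi y).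
Proof. by apply: Cc_mul; exact: cst_continuous. Qed.

Lemma Cc_add phi psi : Cc phi -> Cc psi -> Cc (fun y => phi y + psi y).
Proof.
move=> [cp [r hp]] [cq [s hq]]; split.
  by apply: (@Ck_continuous _ _ 0); apply: CkD; split.
exists (Num.max r s) => y; rewrite gt_max => /andP[yr ys].
by rewrite hp// hq// addr0.
Qed.

Lemma Cc_sum (I : Type) (r : seq I) (F : I -> 'rV[R]_n -> R) :
  (forall l, Cc (F l)) -> Cc (fun y => \sum_(l <- r) F l y).
Proof.
move=> CF; elim: r => [|l r IH].
  under eq_fun do rewrite big_nil; split; first exact: cst_continuous.
  by exists 0.
by under eq_fun do rewrite big_cons; exact: Cc_add.
Qed.

(* With [phi (y - x)] instead of [phi (x - y)] the integrand is [g] times a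
   translate of [phi], as in [poisson_distr]; each derivative of [phi] then
   comes with a sign. *)
Definition conv g phi x : R := integral_Rn (fun y => g y * phi (y - x)).

Lemma conv_translate g phi x a : conv g phi (x + a) = conv g (fun y => phi (y - a)) x.
Proof.
by congr integral_Rn; apply/funext => y; rewrite opprD addrA.
Qed.

Variable g : 'rV[R]_n -> R.
Hypothesis cg : continuous g.

Lemma Cc_conv phi x : Cc phi -> Cc (fun y => g y * phi (y - x)).
Proof. by move=> cp; apply: Cc_mul => //; exact: Cc_translate. Qed.

Lemma convD phi psi x : Cc phi -> Cc psi ->
  conv g (fun y => phi y + psi y) x = conv g phi x + conv g psi x.
Proof.
move=> /(Cc_conv x)[cp bp] /(Cc_conv x)[cq bq]; rewrite /conv -integral_RnD//.
by congr integral_Rn; apply/funext => y; rewrite mulrDr.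
Qed.

Lemma convZ c phi x : Cc phi ->
  conv g (fun y => c * phi y) x = c * conv g phi x.
Proof.
move=> /(Cc_conv x)[cp bp]; rewrite /conv -integral_RnZ//.
by congr integral_Rn; apply/funext => y; rewrite mulrCA.
Qed.

Lemma conv_sum (I : Type) (r : seq I) (F : I -> 'rV[R]_n -> R) x :
  (forall l, Cc (F l)) ->
  conv g (fun y => \sum_(l <- r) F l y) x = \sum_(l <- r) conv g (F l) x.
Proof.
move=> CF; elim: r => [|l r IH].
  rewrite big_nil /conv; under eq_fun do rewrite big_nil mulr0.
  by rewrite /integral_Rn /Rintegral integral0.
rewrite big_cons -IH -convD//; last exact: Cc_sum.
by congr (conv g _ x); apply/funext => y; rewrite big_cons.
Qed.

Variable M : R.
Hypothesis gM : forall y, `|g y| <= M.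

Let M0 : 0 <= M. Proof. exact: le_trans (gM 0). Qed.

Lemma conv_bound phi x r C : Cc phi -> 0 <= r ->
  (forall y, `|phi y| <= C) -> (forall y, r < `|y| -> phi y = 0) ->
  `|conv g phi x| <= M * C * (2 * r) ^+ n.
Proof.
move=> /(Cc_conv x)[cp _] r0 pC p0; apply: (normr_integral_Rn_ball (x := x)) => //.
- by move=> y; rewrite normrM ler_pM.
- by move=> y /p0 ->; rewrite mulr0.
Qed.

Lemma continuous_conv phi : Cc phi -> continuous (conv g phi).
Proof.
move=> Cp; have [cp bp] := Cp; have [s p0] := bp.
have ss := ler_norm s.
(* For shifts shorter than 1 the difference of the two kernels lives in a ball of radius [|s| + 1];
   the final 1 makes [K] positive. *)
pose K := M * (2 * (`|s| + 1)) ^+ n + 1.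
have Ks0 : 0 <= (2 * (`|s| + 1)) ^+ n by rewrite exprn_ge0// mulr_ge0// addr_ge0.
have K0 : 0 < K by rewrite ltr_wpDl// mulr_ge0.
move=> x; apply/(@cvgrPdist_le _ _ _ (nbhs x)) => e e0.
have eK0 : 0 < e / K by rewrite divr_gt0.
have [r r0 rp] := bounded_support_unif_continuous cp bp eK0.
have r10 : 0 < Num.min r 1 by rewrite lt_min r0 ltr01.
apply/nbhs_ballP; exists (Num.min r 1) => // y.
rewrite -ball_normE /ball_/= lt_min distrC => /andP[yr y1].
rewrite distrC -[y](subrK x) [y - x + x]addrC conv_translate.
have -> : conv g (fun z => phi (z - (y - x))) x - conv g phi x =
    conv g (fun z => phi (z - (y - x)) + (-1) * phi z) x.
  by rewrite convD ?convZ ?mulN1r//; [exact: Cc_translate|exact: Cc_scale].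
apply: (@le_trans _ _ (M * (e / K) * (2 * (`|s| + 1)) ^+ n)).
  apply: conv_bound.
  - by apply: Cc_add; [exact: Cc_translate|exact: Cc_scale].
  - by rewrite addr_ge0.
  - by move=> z; rewrite mulN1r; apply: rp; rewrite normrN.
  - move=> z zs; rewrite !p0 ?mulr0 ?addr0//; first lra.
    by have := lerB_normD z (- (y - x)); rewrite normrN; lra.
rewrite mulrAC mulrA ler_pdivrMr// mulrC; apply: ler_wpM2l; first exact: ltW.
by rewrite /K lerDl.
Qed.

(** By the mean value theorem the first-order remainder of [phi] is [- h] times an increment of
    [dphi], small uniformly by uniform continuity; [conv_bound] then integrates it. *)
Lemma is_derive_conv phi (dphi : 'rV[R]_n -> R) v x :
  Cc phi -> Cc dphi -> (forall y, is_derive y v phi (dphi y)) ->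
  is_derive x v (conv g phi) (- conv g dphi x).
Proof.
move=> Cp Cd dp; have [cd bd] := Cd.
have [s p0] := Cp.2; have [s' d0] := bd.
have ss := ler_norm s; have ss' := ler_norm s'.
pose r0 := `|s| + `|s'| + 1.
pose K := M * (2 * r0) ^+ n + 1.
have Ks0 : 0 <= (2 * r0) ^+ n by rewrite exprn_ge0// mulr_ge0// !addr_ge0.
have K0 : 0 < K by rewrite ltr_wpDl// mulr_ge0.
apply/is_derive_epsP => e e0.
have eK0 : 0 < e / K by rewrite divr_gt0.
have [r rr0 rp] := bounded_support_unif_continuous cd bd eK0.
(* Ensures [|h *: v| < Num.min r 1], also when [v = 0]. *)
pose m := Num.min r 1 / (`|v| + 1).
have v0 : 0 < `|v| + 1 by rewrite ltr_wpDl.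
have m0 : 0 < m by rewrite divr_gt0// lt_min rr0 ltr01.
exists m => // h hm.
have : `|h *: v| < Num.min r 1.
  rewrite normrZ; apply: (@le_lt_trans _ _ (`|h| * (`|v| + 1))).
    by rewrite ler_wpM2l// lerDl.
  by rewrite -ltr_pdivlMr.
rewrite lt_min => /andP[hvr hv1].
rewrite conv_translate.
have -> : conv g (fun z => phi (z - h *: v)) x - conv g phi x - h * - conv g dphi x =
    conv g (fun z => phi (z - h *: v) + (-1 * phi z + h * dphi z)) x.
  rewrite convD ?convD ?(convZ _ _ Cp) ?(convZ _ _ Cd)//; first by rewrite mulN1r mulrN opprK addrA.
  - exact: Cc_scale.
  - exact: Cc_scale.
  - exact: Cc_translate.
  - by apply: Cc_add; exact: Cc_scale.
apply: (@le_trans _ _ (M * (e / K * `|h|) * (2 * r0) ^+ n)); last first.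
  rewrite [leLHS](_ : _ = e * `|h| * ((M * (2 * r0) ^+ n) / K)); last first.
    by move: ((2 * r0) ^+ n) (K^-1) => k1 k2; ring.
  apply: ler_piMr; first by rewrite mulr_ge0// ltW.
  by rewrite ler_pdivrMr// mul1r /K lerDl.
apply: conv_bound.
- apply: Cc_add; first exact: Cc_translate.
  by apply: Cc_add; exact: Cc_scale.
- by rewrite !addr_ge0.
- move=> z; have [c ch E] := directional_MVT z (- h) dp.
  have -> : phi (z - h *: v) + (-1 * phi z + h * dphi z) =
      - h * (dphi (z + c *: v) - dphi z).
    by move: E; rewrite scaleNr; lra.
  rewrite normrM normrN mulrC; apply: ler_wpM2r => //; apply: rp.
  apply: le_lt_trans hvr; rewrite !normrZ ler_wpM2r//.
  by rewrite normrN in ch.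
- move=> z; rewrite /r0 => zs.
  have := normr_ge0 s; have := normr_ge0 s' => s0 s'0.
  have := lerB_normD z (- (h *: v)); rewrite normrN => hz.
  by rewrite !p0 ?d0 ?mulr0 ?addr0//; lra.
Qed.

End convolution.

(** * Mollifiers *)

Section mollifiers.
Context {R : realType} {n : nat}.
Implicit Types (phi rho : 'rV[R]_n -> R) (x y a : 'rV[R]_n) (i j : 'I_n).

Local Notation e_ j := (delta_mx ord0 j : 'rV[R]_n).

Lemma test_function_bounded_support phi :
  (forall k, Ck k phi) -> bounded_support phi -> test_function phi.
Proof.
move=> Cphi [r phi0]; split=> //.
have cB : closed [set y : 'rV[R]_n | `|y| <= r].
  apply: (@closed_comp _ _ (fun y : 'rV[R]_n => `|y|) [set t : R | t <= r]).
    by move=> y _; exact: norm_continuous.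
  exact: closed_le.
have sB : closure [set y | phi y != 0] `<=` [set y | `|y| <= r].
  rewrite [X in _ `<=` X](closure_id _).1//; apply: closure_subset => y /= py.
  by rewrite leNgt; apply/negP => /phi0 p0; rewrite p0 eqxx in py.
apply: bounded_closed_compact; last exact: closed_closure.
exists r; split; first exact: num_real.
by move=> M rM y /sB /= yr; rewrite (le_trans yr)// ltW.
Qed.

Lemma bounded_support_partial i phi :
  bounded_support phi -> bounded_support (partial i phi).
Proof.
move=> [r phi0]; exists r => y ry; rewrite /partial.
suff /@derive_val : is_derive y (e_ i) phi 0 by [].
apply/is_derive_epsP => e e0; exists (`|y| - r) => [|h hr]; first by rewrite subr_gt0.
have hi : `|h *: e_ i| <= `|h|.
  apply/mx_norm_leP => // j; rewrite unit_vectorE.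
  by case: (j == i); rewrite ?mulr1 ?mulr0 ?normr0.
have := lerB_normD y (h *: e_ i) => yh.
rewrite !phi0//; last lra.
by rewrite mulr0 !subr0 normr0 mulr_ge0// ltW.
Qed.

(** Positive exactly on the open sup-norm ball of radius [e > 0]. The factors [1] and [-1] match the
    affine form in [Ck_flat]. *)
Definition bump (e : R) y : R :=
  \prod_(j < n) (flat 0 (1 * y ord0 j + e) * flat 0 (-1 * y ord0 j + e)).

Lemma Ck_bump k e : Ck k (bump e).
Proof. by apply: Ck_prod => j; apply: CkM; exact: Ck_flat. Qed.

Lemma bump_ge0 e y : 0 <= bump e y.
Proof. by apply: prodr_ge0 => j _; rewrite mulr_ge0 ?flat_ge0. Qed.

Lemma bump_gt0 e y : `|y| < e -> 0 < bump e y.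
Proof.
move=> ye; apply: prodr_gt0 => j _.
have := mx_coord_le y j; rewrite ler_norml => /andP[h1 h2].
by rewrite mulr_gt0// flat_gt0//; lra.
Qed.

Lemma bump_eq0 e y : 0 < e -> e <= `|y| -> bump e y = 0.
Proof.
move=> e0 ey.
have [j hj] : exists j, e <= `|y ord0 j|.
  have /mx_norm_neq0[[i j] /= yE] : mx_norm y != 0.
    by rewrite gt_eqF//; exact: lt_le_trans ey.
  by exists j; rewrite (_ : ord0 = i) -?yE// (ord1 i).
rewrite /bump (bigD1 j)//=.
have [y0|y0] := leP 0 (y ord0 j).
  rewrite (@flat0 _ _ (-1 * _ + e)) ?mulr0 ?mul0r//.
  by move: hj; rewrite ger0_norm//; lra.
rewrite (@flat0 _ _ (1 * _ + e)) ?mul0r//.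
by move: hj; rewrite ltr0_norm//; lra.
Qed.

Lemma bounded_support_bump e : 0 < e -> bounded_support (bump e).
Proof. by move=> e0; exists e => y /ltW/(bump_eq0 e0). Qed.

(** The minimum of the bump over the compact cube of radius [e / 2] is positive and bounds the
    integral from below. *)
Lemma integral_bump_gt0 e : 0 < e -> 0 < integral_Rn (bump e).
Proof.
move=> e0; have cb : continuous (bump e) by exact: (Ck_continuous (Ck_bump 0 e)).
pose Q := [set y : 'rV[R]_n | forall j, y ord0 j \in `[- (e / 2), e / 2]].
have cQ : compact Q.
  apply: (@rV_compact _ _ (fun=> `[- (e / 2), e / 2]%classic)) => j.
  exact: segment_compact.
have e20 : 0 <= e / 2 by rewrite divr_ge0// ltW.
have QP y : Q y <-> `|y| <= e / 2.
  split=> [h|/(mx_norm_leP _ e20) h j].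
    by apply/mx_norm_leP => // j; have := h j; rewrite in_itv/= -ler_norml.
  by rewrite in_itv/= -ler_norml.
have Q0 : Q 0 by apply/QP; rewrite normr0.
have [c cQ' bc] := compact_EVT_min (ex_intro _ _ Q0) cQ (continuous_subspaceT cb).
have c0 : 0 < bump e c.
  by apply: bump_gt0; move: cQ'; rewrite inE => /QP; lra.
have := @integral_Rn_ge_ball _ _ (bump e) 0 (e / 2) (bump e c) cb e20 (ltW c0)
  (bump_ge0 e).
move=> /(_ _ (bounded_support_bump e0)) h; apply: lt_le_trans (h _).
  by rewrite mulr_gt0// exprn_gt0//; lra.
by move=> y; rewrite subr0 => /QP Qy; apply: bc; rewrite inE.
Qed.

Record mollifier (e : R) rho : Prop := Mollifier {
  mollifier_smooth : forall k, Ck k rho;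
  mollifier_ge0 : forall y, 0 <= rho y;
  mollifier_eq0 : forall y, e < `|y| -> rho y = 0;
  mollifier_integral : integral_Rn rho = 1 }.

Lemma mollifier_exists e : 0 < e -> exists rho, mollifier e rho.
Proof.
move=> e0; have I0 := integral_bump_gt0 e0.
exists (fun y => (integral_Rn (bump e))^-1 * bump e y); split.
- by move=> k; apply: CkM; [exact: Ck_cst|exact: Ck_bump].
- by move=> y; rewrite mulr_ge0 ?bump_ge0// invr_ge0 ltW.
- by move=> y /ltW/(bump_eq0 e0) ->; rewrite mulr0.
- rewrite integral_RnZ ?mulVf ?gt_eqF//; last exact: bounded_support_bump.
  exact: (Ck_continuous (Ck_bump 0 e)).
Qed.

Section mollify.
Variables (e : R) (rho : 'rV[R]_n -> R) (mrho : mollifier e rho).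

Lemma mollifier_Cc : Cc rho.
Proof.
split; first exact: (Ck_continuous (mollifier_smooth mrho 0)).
by exists e; exact: mollifier_eq0.
Qed.

Lemma mollifier_translate_integral x : integral_Rn (fun y => rho (y - x)) = 1.
Proof.
rewrite integral_Rn_translate ?(mollifier_integral mrho)//.
  by have [] := mollifier_Cc.
exact: mollifier_ge0 mrho.
Qed.

Lemma mollify_bound g M x : continuous g -> (forall y, `|g y| <= M) ->
  `|conv g rho x| <= M.
Proof.
move=> cg gM.
have [c1 b1] := Cc_conv cg x mollifier_Cc.
have C2 : Cc (fun y => rho (y - x)) by apply: Cc_translate; exact: mollifier_Cc.
apply: le_trans (normr_integral_Rn c1 b1) _.
have -> : M = integral_Rn (fun y => M * rho (y - x)).
  by have [c2 b2] := C2; rewrite integral_RnZ// mollifier_translate_integral mulr1.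
have [c3 b3] := Cc_scale M C2.
apply: le_integral_Rn => //.
- by move=> y; apply: (@continuous_comp _ _ _ (fun y => g y * rho (y - x)) Num.norm);
    [exact: c1|exact: norm_continuous].
- by have [s h] := b1; exists s => y /h ->; rewrite normr0.
- move=> y; rewrite normrM (ger0_norm (mollifier_ge0 mrho _)) ler_wpM2r//.
  exact: mollifier_ge0 mrho _.
Qed.

Lemma conv_cst_sub g x : continuous g ->
  conv g rho x - g x = conv (fun y => g y - g x) rho x.
Proof.
move=> cg.
have C2 : Cc (fun y => rho (y - x)) by apply: Cc_translate; exact: mollifier_Cc.
have [c2 b2] := C2; have [c1 b1] := Cc_conv cg x mollifier_Cc.
have [c3 b3] := Cc_scale (g x) C2.
rewrite -[X in _ - X]mulr1 -(mollifier_translate_integral x) -integral_RnZ//.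
rewrite /conv -integral_RnB//.
by congr integral_Rn; apply/funext => y; rewrite mulrBl.
Qed.

(** Localised at one [x], it yields pointwise convergence from continuity of [u] and uniform
    convergence from uniform continuity of [f]. *)
Lemma mollify_close g (eta : R) x : continuous g ->
  (forall y, `|y - x| <= e -> `|g y - g x| <= eta) ->
  `|conv g rho x - g x| <= eta.
Proof.
move=> cg gx; rewrite conv_cst_sub//.
have cg' : continuous (fun y => g y - g x).
  by move=> y; apply: (@cvgB _ _ _ (nbhs y)); [exact: cg|exact: cvg_cst].
have [c1 b1] := Cc_conv cg' x mollifier_Cc.
have C2 : Cc (fun y => rho (y - x)) by apply: Cc_translate; exact: mollifier_Cc.
apply: le_trans (normr_integral_Rn c1 b1) _.
have -> : eta = integral_Rn (fun y => eta * rho (y - x)).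
  by have [c2 b2] := C2; rewrite integral_RnZ// mollifier_translate_integral mulr1.
have [c3 b3] := Cc_scale eta C2.
apply: le_integral_Rn => //.
- by move=> y; apply: (@continuous_comp _ _ _ (fun y => (g y - g x) * rho (y - x)) Num.norm);
    [exact: c1|exact: norm_continuous].
- by have [s h] := b1; exists s => y /h ->; rewrite normr0.
- move=> y; have [yx|yx] := leP `|y - x| e; last first.
    by rewrite (mollifier_eq0 mrho yx) !mulr0 normr0.
  by rewrite normrM (ger0_norm (mollifier_ge0 mrho _)) ler_wpM2r ?gx//; exact: mollifier_ge0 mrho _.
Qed.

End mollify.

(** Each derivative moves onto [phi] with a minus sign; the two signs cancel in the Laplacian. *)
Lemma Ck2_conv g M phi : continuous g -> (forall y, `|g y| <= M) ->
  (forall k, Ck k phi) -> bounded_support phi ->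
  Ck 2 (conv g phi) /\ laplacian (conv g phi) = conv g (laplacian phi).
Proof.
move=> cg gM Cphi sphi.
have [_ h] := Cphi 2.
have P i x : is_derive x (e_ i) phi (partial i phi x).
  by have [h1 _] := h i; exact: derivableP.
have P2 i j x : is_derive x (e_ j) (partial i phi) (partial j (partial i phi) x).
  by have [_ [_ h2]] := h i; have [h3 _] := h2 j; exact: derivableP.
have C0 : Cc phi by split => //; exact: Ck_continuous (Cphi 0).
have C1 i : Cc (partial i phi).
  split; last exact: bounded_support_partial.
  by have [_ []] := h i.
have C2 i j : Cc (partial j (partial i phi)).
  split; last by do 2 apply: bounded_support_partial.
  by have [_ [_ h2]] := h i; have [_ []] := h2 j.
have D1 i x : is_derive x (e_ i) (conv g phi) (- conv g (partial i phi) x).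
  exact: (is_derive_conv cg gM x C0 (C1 i) (P i)).
have D2 i j x : is_derive x (e_ j) (fun x => - conv g (partial i phi) x)
    (conv g (partial j (partial i phi)) x).
  rewrite -[X in is_derive _ _ _ X]opprK; apply: is_deriveN.
  exact: (is_derive_conv cg gM x (C1 i) (C2 i j) (P2 i j)).
have E1 i : partial i (conv g phi) = fun x => - conv g (partial i phi) x.
  by apply/funext => x; have /@derive_val := D1 i x.
have E2 i j : partial j (partial i (conv g phi)) = conv g (partial j (partial i phi)).
  by rewrite E1; apply/funext => x; have /@derive_val := D2 i j x.
split; last first.
  apply/funext => x; rewrite /laplacian (conv_sum cg)//.
  by apply: eq_bigr => i _; rewrite E2.
apply/CkP; split; first exact: (continuous_conv cg gM C0).
move=> i; exists (fun x => - conv g (partial i phi) x) => //.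
apply/CkP; split.
  by move=> x; apply: continuousN; exact: (continuous_conv cg gM (C1 i)).
move=> j; exists (conv g (partial j (partial i phi))) => //; split=> //.
exact: (continuous_conv cg gM (C2 i j)).
Qed.

(** Testing the equation with [rho] translated by [x] makes both sides convolutions evaluated at
    [x]. *)
Lemma laplacian_mollify (u f rho : 'rV[R]_n -> R) (M e : R) x :
  continuous u -> (forall y, `|u y| <= M) -> poisson_distr u f -> mollifier e rho ->
  laplacian (conv u rho) x = - conv f rho x.
Proof.
move=> cu uM uf mrho.
have Cr := mollifier_smooth mrho; have [_ br] := mollifier_Cc mrho.
rewrite (Ck2_conv cu uM Cr br).2.
have tr : test_function (fun y => rho (y - x)).
  apply: test_function_bounded_support; first by move=> k; exact: Ck_translate.
  by have [] := Cc_translate (- x) (mollifier_Cc mrho).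
have := uf _ tr; rewrite laplacian_translate; last exact: Cr.
by rewrite -[integral_Rn (fun y => f y * _)]/(conv f rho x) => <-; rewrite opprK.
Qed.

End mollifiers.

(** * Almost periodic functions *)

Section uniform_limits.
Context {R : realType} {n : nat}.
Implicit Types (f h : 'rV[R]_n -> R) (F : nat -> 'rV[R]_n -> R).

Lemma uniform_cvgP F h : {uniform, F @ \oo --> h} <->
  forall e, 0 < e -> exists K, forall k x, (K <= k)%N -> `|F k x - h x| <= e.
Proof.
split=> [H e e0|H P /uniform_nbhs[E [entE EP]]].
  have : nbhs (h : {uniform 'rV[R]_n -> R}) [set g | forall x, `|g x - h x| <= e].
    apply/uniform_nbhs; exists [set xy | ball xy.1 e xy.2].
    split; first exact: (entourage_ball _ (PosNum e0)).
    by move=> g /= hg x; have := hg x I; rewrite -ball_normE /= distrC => /ltW.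
  by move=> /H [K _ KP]; exists K => k x Kk; exact: KP.
move: entE; rewrite -entourage_ballE => -[e /= e0 eE].
have e20 : 0 < e / 2 by rewrite divr_gt0.
have [K HK] := H (e / 2) e20; exists K => // k /= Kk; apply: EP => x _.
apply: eE; rewrite /= -ball_normE /= distrC.
by apply: le_lt_trans (HK k x Kk) _; lra.
Qed.

Lemma uniform_cauchy_cvg F :
  (forall e, 0 < e -> exists K, forall k l x, (K <= k)%N -> (K <= l)%N ->
    `|F k x - F l x| <= e) ->
  exists h, {uniform, F @ \oo --> h}.
Proof.
move=> H.
have c x : cvg (F k x @[k --> \oo]).
  apply/cauchy_cvgP/cauchy_exP => e e0.
  have e20 : 0 < e / 2 by rewrite divr_gt0.
  have [K HK] := H _ e20; exists (F K x); exists K => // k /= Kk.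
  rewrite -ball_normE /=; apply: le_lt_trans (HK K k x (leqnn K) Kk) _; lra.
exists (fun x => lim (F k x @[k --> \oo])); apply/uniform_cvgP => e e0.
have e20 : 0 < e / 2 by rewrite divr_gt0.
have [K HK] := H _ e20; exists K => k x Kk.
have /cvgrPdist_le/(_ _ e20)[L _ HL] := c x.
have h1 := HL (maxn K L) (leq_maxr _ _).
have h2 := HK k (maxn K L) x Kk (leq_maxl _ _).
rewrite -[_ - _](subrKA (F (maxn K L) x)); apply: le_trans (ler_normD _ _) _.
by rewrite [X in _ + X]distrC; move: h1 => /=; lra.
Qed.

(** The Cauchy form compares two translates directly, as the gradient estimate requires. *)
Lemma almost_periodic_cauchy f (xs : nat -> 'rV[R]_n) : almost_periodic f ->
  exists2 s : nat -> nat, {homo s : i j / (i < j)%N} &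
  forall e, 0 < e -> exists K, forall k l x, (K <= k)%N -> (K <= l)%N ->
    `|f (x + xs (s k)) - f (x + xs (s l))| <= e.
Proof.
move=> [_ /(_ xs)[s [sI [h /uniform_cvgP H]]]]; exists s => // e e0.
have e20 : 0 < e / 2 by rewrite divr_gt0.
have [K HK] := H _ e20; exists K => k l x Kk Kl.
have h1 := HK k x Kk; have h2 := HK l x Kl.
rewrite -[_ - _](subrKA (h x)); apply: le_trans (ler_normD _ _) _.
by rewrite [X in _ + X]distrC; lra.
Qed.

(** Otherwise jumps larger than [e] occur at points [(p k).1] under shifts tending to 0. Along a
    Cauchy subsequence of translates these jumps are carried to the fixed point [(p (s K)).1], where
    [f] is continuous. *)
Lemma almost_periodic_unif_continuous f : almost_periodic f ->
  forall e, 0 < e ->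
  exists2 r, 0 < r & forall x z, `|z| < r -> `|f (x + z) - f x| <= e.
Proof.
move=> apf e e0; apply: contrapT => nH.
have /choice[p Hp] : forall k, exists q : 'rV[R]_n * 'rV[R]_n,
    `|q.2| < k.+1%:R^-1 /\ e < `|f (q.1 + q.2) - f q.1|.
  move=> k; apply: contrapT => nk; apply: nH.
  exists k.+1%:R^-1; first by rewrite invr_gt0 ltr0n.
  move=> x z zk; rewrite leNgt; apply/negP => h.
  by apply: nk; exists (x, z).
have [s sI H] := almost_periodic_cauchy (fun k => (p k).1) apf.
have e40 : 0 < e / 4 by rewrite divr_gt0.
have [K HK] := H _ e40.
have /cvgrPdist_le/(_ _ e40)/nbhs_ballP[r /= r0 Hr] := apf.1 (p (s K)).1.
have [L _ HL] := near_infty_natSinv_lt (PosNum r0).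
(* Past [K] the translates are [e / 4]-close; past [L], since [k <= s k], the shift is shorter than
   [r]. *)
pose k := maxn K L.
have sk : (k <= s k)%N.
  by elim: {1 2}k => // m IH; apply: leq_ltn_trans IH _; exact: sI.
have [h1 h2] := Hp (s k).
have zr : `|(p (s k)).2| < r.
  by apply: lt_trans h1 _; apply: HL => /=; apply: leq_trans sk; exact: leq_maxr.
have h3 := HK k K (p (s k)).2 (leq_maxl _ _) (leqnn K).
have h4 := HK k K 0 (leq_maxl _ _) (leqnn K).
rewrite !add0r in h4.
have h5 : `|f (p (s K)).1 - f ((p (s k)).2 + (p (s K)).1)| <= e / 4.
  by apply: Hr; rewrite -ball_normE /= opprD addrCA subrr addr0 normrN.
have : `|f ((p (s k)).1 + (p (s k)).2) - f (p (s k)).1| <= e / 4 + e / 4 + e / 4.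
  rewrite [(p (s k)).1 + _]addrC; move: h3 h4 h5; rewrite !ler_norml.
  by move=> /andP[? ?] /andP[? ?] /andP[? ?]; apply/andP; split; lra.
by apply/negP; rewrite -ltNge; lra.
Qed.

End uniform_limits.

Section real_inequalities.
Context {R : realType}.
Implicit Types (p q s t e C : R).

(** Used with Laplacians [p], [q] and values [s], [t] of [f]; the sums reflect the sign in
    [-laplacian = f]. *)
Lemma ler_distB_add p q s t e C :
  `|p + s| <= e -> `|q + t| <= e -> `|s - t| <= C -> `|p - q| <= C + e + e.
Proof.
rewrite !ler_norml => /andP[? ?] /andP[? ?] /andP[? ?].
by apply/andP; split; lra.
Qed.

Lemma ler_dist_increment p1 q1 p0 q0 s1 t1 s0 t0 e C :
  `|(p1 - q1) - (p0 - q0)| <= C ->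
  `|p1 - s1| <= e -> `|q1 - t1| <= e -> `|p0 - s0| <= e -> `|q0 - t0| <= e ->
  `|(s1 - t1) - (s0 - t0)| <= C + (e + e + e + e).
Proof.
rewrite !ler_norml => /andP[? ?] /andP[? ?] /andP[? ?] /andP[? ?] /andP[? ?].
by apply/andP; split; lra.
Qed.

End real_inequalities.

(** * The gradient of a bounded solution *)

Section gradient_estimates.
Context {R : realType} {n : nat}.
Implicit Types (x y a b : 'rV[R]_n) (i : 'I_n).

Local Notation e_ j := (delta_mx ord0 j : 'rV[R]_n).

Lemma CkB k (f g : 'rV[R]_n -> R) : Ck k f -> Ck k g -> Ck k (fun x => f x - g x).
Proof.
move=> Cf Cg; rewrite (_ : (fun x => _) = (fun x => f x + -1 * g x)).
  by apply: CkD => //; apply: CkM => //; exact: Ck_cst.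
by apply/funext => x; rewrite mulN1r.
Qed.

Lemma laplacianB (f g : 'rV[R]_n -> R) x : Ck 2 f -> Ck 2 g ->
  laplacian (fun x => f x - g x) x = laplacian f x - laplacian g x.
Proof.
move=> [_ hf] [_ hg]; rewrite /laplacian -sumrB; apply: eq_bigr => i _.
have [f1 [_ f2]] := hf i; have [f3 _] := f2 i.
have [g1 [_ g2]] := hg i; have [g3 _] := g2 i.
have -> : partial i (fun x => f x - g x) = (fun x => partial i f x - partial i g x).
  by apply/funext => y; rewrite /partial (deriveB (f1 y) (g1 y)).
by rewrite /partial (deriveB (f3 x) (g3 x)).
Qed.

(* A form of the interpolation inequality [|grad w|^2 <= C |w| |laplacian w|]
   that passes to pointwise limits of w. *)
Lemma increment_small (M eta : R) : 0 <= M -> 0 < eta ->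
  exists2 N, 0 < N & forall w x h i, Ck 2 w -> (forall y, `|w y| <= M) ->
    (forall y, `|laplacian w y| < N) -> `|h| <= 2 ->
    `|w (x + h *: e_ i) - w x| <= eta * `|h|.
Proof.
move=> M0 eta0.
(* Makes [n * M / d] at most [eta / 2]; then [N = eta / d] makes the other term exactly [eta / 2],
   and [d >= 1] covers every [|h| <= 2]. *)
pose d := 1 + 2 * n%:R * M / eta.
have d1 : 1 <= d by rewrite lerDl divr_ge0 ?mulr_ge0// ltW.
have d0 : 0 < d by lra.
exists (eta / d); first by rewrite divr_gt0.
move=> w x h i Cw wM wN h2.
have hd : `|h| <= 2 * d by lra.
apply: le_trans (increment_le i x Cw wM wN d0 hd) _.
rewrite mulrC; apply: ler_wpM2r => //.
have -> : eta / d * d / 2 = eta / 2 by rewrite divfK// gt_eqF.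
have : n%:R * M / d <= eta / 2.
  rewrite ler_pdivrMr// /d mulrDr mulr1.
  rewrite [X in _ <= _ + X](_ : _ = n%:R * M); last by field; rewrite gt_eqF.
  by rewrite lerDr divr_ge0// ltW.
by lra.
Qed.

Variables (f u : 'rV[R]_n -> R) (M : R).
Hypothesis apf : almost_periodic f.
Hypothesis cu : continuous u.
Hypothesis uM : forall y, `|u y| <= M.
Hypothesis uf : poisson_distr u f.

Let M0 : 0 <= M. Proof. exact: le_trans (uM 0). Qed.

Lemma mollify_cvg y (eta : R) : 0 < eta -> exists2 r, 0 < r &
  forall e rho, e < r -> mollifier e rho -> `|conv u rho y - u y| <= eta.
Proof.
move=> eta0; have /cvgrPdist_le/(_ _ eta0)/nbhs_ballP[r /= r0 Hr] := @cu y.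
exists r => // e rho er mrho; apply: (mollify_close mrho) => // z ze.
rewrite distrC; apply: Hr; rewrite -ball_normE /= distrC.
exact: le_lt_trans er.
Qed.

Lemma laplacian_mollify_cvg (eta : R) : 0 < eta -> exists2 r, 0 < r &
  forall e rho, e < r -> mollifier e rho ->
    forall y, `|laplacian (conv u rho) y + f y| <= eta.
Proof.
move=> eta0; have [r r0 Hr] := almost_periodic_unif_continuous apf eta0.
exists r => // e rho er mrho y; rewrite (laplacian_mollify _ cu uM uf mrho).
rewrite addrC distrC; apply: (mollify_close mrho); first by case: apf.
by move=> z ze; rewrite -{1}(subrK y z) [z - y + y]addrC; apply: Hr; exact: le_lt_trans er.
Qed.

Let Ck2 e rho : mollifier e rho -> Ck 2 (conv u rho).
Proof.
move=> mrho; have [_ b] := mollifier_Cc mrho.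
by have [] := Ck2_conv cu uM (mollifier_smooth mrho) b.
Qed.

(** [increment_small] is applied to the difference of two mollifications. The radius of [rho]
    depends on [eta] only; that of [rho'] shrinks with [x], [h] and [e], so pointwise convergence is
    enough to reach [u]. *)
Lemma increment_mollify i (eta : R) : 0 < eta ->
  exists2 v, Ck 2 v & forall x h, `|h| <= 2 ->
    `|(v (x + h *: e_ i) - u (x + h *: e_ i)) - (v x - u x)| <= eta * `|h|.
Proof.
move=> eta0.
have M20 : 0 <= 2 * M by rewrite mulr_ge0.
have [N N0 HN] := increment_small M20 eta0.
have N30 : 0 < N / 3 by rewrite divr_gt0.
have Nlt : 0 + N / 3 + N / 3 < N by lra.
have [r r0 Hr] := laplacian_mollify_cvg N30.
have [rho mrho] : exists rho, mollifier (n := n) (r / 2) rho.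
  by apply: mollifier_exists; rewrite divr_gt0.
exists (conv u rho) => [|x h h2]; first exact: Ck2 mrho.
apply/ler_addgt0Pr => e e0; have e40 : 0 < e / 4 by rewrite divr_gt0.
have [r1 r10 H1] := mollify_cvg x e40.
have [r2 r20 H2] := mollify_cvg (x + h *: e_ i) e40.
pose d := Num.min r (Num.min r1 r2) / 2.
have : 0 < Num.min r (Num.min r1 r2) by rewrite !lt_min r0 r10 r20.
move=> m0; have d0 : 0 < d by rewrite divr_gt0.
have [] : [/\ d < r, d < r1 & d < r2].
  have : d < Num.min r (Num.min r1 r2) by rewrite /d; lra.
  by rewrite !lt_min => /and3P[].
move=> dr dr1 dr2; have [rho' mrho'] := mollifier_exists (n := n) d0.
have := HN (fun y => conv u rho y - conv u rho' y) x h i.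
move=> /(_ (CkB (Ck2 mrho) (Ck2 mrho'))) H.
have {}H : `|(conv u rho (x + h *: e_ i) - conv u rho' (x + h *: e_ i)) -
    (conv u rho x - conv u rho' x)| <= eta * `|h|.
  apply: H => // y.
    rewrite mulr_natl mulr2n; apply: le_trans (ler_normB _ _) _.
    exact: lerD (mollify_bound mrho y cu uM) (mollify_bound mrho' y cu uM).
  rewrite (laplacianB _ (Ck2 mrho) (Ck2 mrho')).
  have rr : r / 2 < r by lra.
  have h1 := Hr _ _ rr mrho y; have h3 := Hr _ _ dr mrho' y.
  have fy0 : `|f y - f y| <= 0 by rewrite subrr normr0.
  exact: le_lt_trans (ler_distB_add h1 h3 fy0) Nlt.
have h1 := H1 _ _ dr1 mrho'; have h3 := H2 _ _ dr2 mrho'.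
have -> : e = e / 4 + e / 4 + e / 4 + e / 4 by field.
by apply: (ler_dist_increment H) => //; rewrite subrr normr0 ltW.
Qed.

(** [increment_small] for the difference of two translates of one mollification, whose Laplacian is
    within [N / 2] of [f (y + b) - f (y + a)], with its [N]. The threshold obtained depends on
    neither [a] nor [b]. *)
Lemma increment_translate i (eta : R) : 0 < eta ->
  exists2 N, 0 < N & forall a b, (forall y, `|f (y + a) - f (y + b)| <= N) ->
  forall x h, `|h| <= 2 ->
    `|(u (x + h *: e_ i + a) - u (x + h *: e_ i + b)) - (u (x + a) - u (x + b))|
      <= eta * `|h|.
Proof.
move=> eta0.
have M20 : 0 <= 2 * M by rewrite mulr_ge0.
have [N N0 HN] := increment_small M20 eta0.
have N40 : 0 < N / 4 by rewrite divr_gt0.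
have Nlt : N / 4 + N / 4 + N / 4 < N by lra.
have [r r0 Hr] := laplacian_mollify_cvg N40.
exists (N / 4) => // a b fab x h h2.
apply/ler_addgt0Pr => e e0; have e40 : 0 < e / 4 by rewrite divr_gt0.
have [r1 r10 H1] := mollify_cvg (x + h *: e_ i + a) e40.
have [r2 r20 H2] := mollify_cvg (x + h *: e_ i + b) e40.
have [r3 r30 H3] := mollify_cvg (x + a) e40.
have [r4 r40 H4] := mollify_cvg (x + b) e40.
pose m := Num.min r (Num.min (Num.min r1 r2) (Num.min r3 r4)).
have m0 : 0 < m by rewrite !lt_min r0 r10 r20 r30 r40.
have d0 : 0 < m / 2 by rewrite divr_gt0.
have : m / 2 < m by lra.
rewrite {2}/m !lt_min => /and3P[dr /andP[dr1 dr2] /andP[dr3 dr4]].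
have [rho mrho] := mollifier_exists (n := n) d0.
pose w y := conv u rho (y + a) - conv u rho (y + b).
have Ca := Ck_translate a (Ck2 mrho); have Cb := Ck_translate b (Ck2 mrho).
have H : `|w (x + h *: e_ i) - w x| <= eta * `|h|.
  apply: (HN w x h i (CkB Ca Cb) _ _ h2).
    move=> y; rewrite mulr_natl mulr2n; apply: le_trans (ler_normB _ _) _.
    exact: lerD (mollify_bound mrho (y + a) cu uM) (mollify_bound mrho (y + b) cu uM).
  move=> y; rewrite (laplacianB _ Ca Cb).
  rewrite (laplacian_translate a (Ck2 mrho)) (laplacian_translate b (Ck2 mrho)).
  have h1 := Hr _ _ dr mrho (y + a); have h3 := Hr _ _ dr mrho (y + b).
  exact: le_lt_trans (ler_distB_add h1 h3 (fab y)) Nlt.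
have -> : e = e / 4 + e / 4 + e / 4 + e / 4 by field.
apply: (ler_dist_increment H); [exact: H1 mrho|exact: H2 mrho|exact: H3 mrho|].
exact: H4 mrho.
Qed.

(** The difference quotients of [u] stay within [e / 4] of those of a smooth [v], so [partial i v x]
    is a centre for the Cauchy criterion. *)
Lemma has_partial_solution i : has_partial i u.
Proof.
move=> x; apply/cauchy_cvgP/cauchy_exP => e e0.
have e40 : 0 < e / 4 by rewrite divr_gt0.
have [v Cv H] := increment_mollify i e40.
have [_ hv] := Cv; have [h1 _] := hv i.
have /is_derive_epsP/(_ _ e40)[r r0 Hr] : is_derive x (e_ i) v (partial i v x).
  exact: (derivableP (h1 x)).
exists (partial i v x); apply/nbhs_ballP; exists (Num.min r 2).
  by rewrite /= lt_min r0 /=.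
move=> h /=; rewrite /ball/= sub0r normrN lt_min => /andP[hr h2] h0.
rewrite /= [_ *: _]/(_^-1 * _) -(ltr_pM2l (_ : 0 < `|h|)) ?normr_gt0//.
rewrite -normrM mulrBr mulrA mulfV// mul1r [h *: _ + x]addrC.
have := H x h (ltW h2); have := Hr h hr.
have hp : 0 < `|h| by rewrite normr_gt0.
have : e / 4 * `|h| + e / 4 * `|h| < `|h| * e by rewrite -mulrDl mulrC ltr_pM2l//; lra.
rewrite ltr_norml !ler_norml => ? /andP[? ?] /andP[? ?].
by apply/andP; split; lra.
Qed.

Lemma partial_translate_close i (eta : R) : 0 < eta ->
  exists2 N, 0 < N & forall a b, (forall y, `|f (y + a) - f (y + b)| <= N) ->
  forall x, `|partial i u (x + a) - partial i u (x + b)| <= eta.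
Proof.
move=> eta0; have eta30 : 0 < eta / 3 by rewrite divr_gt0.
have [N N0 H] := increment_translate i eta30.
exists N => // a b fab x.
have d y : is_derive y (e_ i) u (partial i u y).
  exact: (derivableP (@has_partial_solution i y)).
have /is_derive_epsP/(_ _ eta30)[r1 r10 H1] := d (x + a).
have /is_derive_epsP/(_ _ eta30)[r2 r20 H2] := d (x + b).
pose m := Num.min 2 (Num.min r1 r2).
have m0 : 0 < m by rewrite !lt_min r10 r20 !andbT.
(* One small step replaces a limit: two expansions and the increment bound each cost
   [eta / 3 * h]. *)
pose h := m / 2; have h0 : 0 < h by rewrite divr_gt0.
have : h < m by rewrite /h; lra.
rewrite /m !lt_min => /and3P[hh2 hr1 hr2].
have := H a b fab x h; have := H1 h; have := H2 h.
rewrite gtr0_norm// => /(_ hr2) A2 /(_ hr1) A1 /(_ (ltW hh2)) A0.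
rewrite -(ler_pM2l h0) -{1}(gtr0_norm h0) -normrM.
move: A0 A1 A2; rewrite ![x + _ + h *: _]addrAC !ler_norml.
move=> /andP[? ?] /andP[? ?] /andP[? ?].
by apply/andP; split; lra.
Qed.

(** A small displacement is a translation under which [f] varies uniformly little. *)
Lemma continuous_partial_solution i : continuous (partial i u).
Proof.
move=> x; apply/(@cvgrPdist_le _ _ _ (nbhs x)) => e e0.
have [N N0 H] := partial_translate_close i e0.
have [r r0 Hr] := almost_periodic_unif_continuous apf N0.
apply/nbhs_ballP; exists r => // y; rewrite -ball_normE /= => xy.
have := H 0 (y - x) _ x; rewrite addr0 [x + (y - x)]addrC subrK; apply.
by move=> z; rewrite addr0 distrC; apply: Hr; rewrite distrC.
Qed.

(** The subsequence extracted for [f] serves unchanged for the partial derivative. *)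
Lemma almost_periodic_partial_solution i : almost_periodic (partial i u).
Proof.
split=> [|xs]; first exact: continuous_partial_solution.
have [s sI Hs] := almost_periodic_cauchy xs apf.
exists s; split=> //; apply: uniform_cauchy_cvg => e e0.
have [N N0 H] := partial_translate_close i e0.
have [K HK] := Hs N N0; exists K => k l x Kk Kl.
by apply: H => y; exact: HK.
Qed.

End gradient_estimates.

Unset Implicit Arguments.

Theorem theorem2p1 (R : realType) (n : nat) (hn : (0 < n)%N)
    (f u : 'rV[R]_n -> R) (hf : almost_periodic f)
    (hu_bounded : bounded_fun u) (hu_continuous : continuous u)
    (hu : poisson_distr u f) :
  forall i : 'I_n,
    has_partial i u /\ continuous (partial i u) /\
    almost_periodic (partial i u).
Proof.
move=> i.
(* [bounded_fun] gives the bound for every real strictly above some [M], hence [M + 1]. *)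
have [M uM] : exists M, forall y, `|u y| <= M.
  by have [M [_ HM]] := hu_bounded; exists (M + 1) => y; apply: HM; rewrite ?ltrDl.
split; first exact: has_partial_solution hf hu_continuous uM hu i.
split; first exact: continuous_partial_solution hf hu_continuous uM hu i.
exact: almost_periodic_partial_solution hf hu_continuous uM hu i.
Qed.
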